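(* Let $N\ge 2$, let $M,M'\subset\mathbb{C}^N$ be formal real hypersurfaces, and assume that $M$ belongs to the class $\mathcal{C}$. Then every formal holomorphic map $H\colon(\mathbb{C}^N,0)\to(\mathbb{C}^N,0)$ sending $M$ into $M'$ and satisfying $\mathrm{Jac}\,H\not\equiv 0$ is CR-transversal.
   Context: For a formal power series $h(x)$ with complex coefficients, $\bar h(x)$ is the series obtained by conjugating the coefficients (similarly for formal maps). The generic rank of a formal map $F(x)$ is the largest $r$ such that some $r\times r$ minor of the Jacobian matrix $\partial F/\partial x$ is a nonzero formal power series. $\mathrm{Jac}\,H$ denotes the Jacobian determinant of $H$, a formal power series. Formal real hypersurface $M\subset\mathbb{C}^N$ (through $0$): given by $r\in\mathbb{C}[[Z,\zeta]]$, $(Z,\zeta)\in\mathbb{C}^N\times\mathbb{C}^N$, with $\bar r(\zeta,Z)=r(Z,\zeta)$, $r(0)=0$ and $\partial_Z r(0)\neq 0$; $\mathcal{I}(M)$ is the ideal of $\mathbb{C}[[Z,\zeta]]$ generated by $r$, and $T^{1,0}_0M=\ker\partial_Zr(0)\subset T_0\mathbb{C}^N$. Normal coordinates: there is a formal change of coordinates $Z=Z(z,w)$ of $\mathbb{C}^N$, $z\in\mathbb{C}^{N-1}$, $w\in\mathbb{C}$, with associated change $\zeta=\bar Z(\chi,\tau)$, $\chi\in\mathbb{C}^{N-1}$, $\tau\in\mathbb{C}$, such that $M$ is defined by $w-Q(z,\chi,\tau)$, where $Q\in\mathbb{C}[[z,\chi,\tau]]$ satisfies $Q(0,\chi,\tau)=Q(z,0,\tau)=\tau$.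 Class $\mathcal{C}$: $M$ belongs to the class $\mathcal{C}$ if, in normal coordinates, for $k$ large enough the formal map $\chi\mapsto\big(Q_{z^\alpha}(0,\chi,0)\big)_{|\alpha|\le k}$ has generic rank $N-1$ (this is independent of the choice of normal coordinates). Maps: a formal holomorphic map $H\colon(\mathbb{C}^N,0)\to(\mathbb{C}^N,0)$ sends $M$ (defined by $r$) into $M'$ (defined by $r'$) if $r'(H(Z),\bar H(\zeta))\in\mathcal{I}(M)$. $H$ is CR-transversal if $T^{1,0}_0M'+dH(T_0\mathbb{C}^N)=T_0\mathbb{C}^N$, where $dH$ is the differential of $H$ at $0$. If $(z,w)$ and $(z',w')$ are normal coordinates for $M$ and $M'$ and $H=(F,G)$ with $F$ having $N-1$ components and $G$ scalar, then $H$ is CR-transversal iff $\partial G/\partial w(0)\ne 0$. *)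

(* Defs.v *)
From HB Require Import structures.
From mathcomp Require Import all_boot all_order all_algebra.
From mathcomp Require Import boolp reals complex mpoly.

Set Implicit Arguments.
Unset Strict Implicit.
Unset Printing Implicit Defensive.

Import GRing.Theory Num.Theory.
Local Open Scope ring_scope.

Record fps (A : Type) (n : nat) := FPS { fps_fun : 'X_{1..n} -> A }.

Definition fcoef (A : Type) (n : nat) (m : 'X_{1..n}) (f : fps A n) : A :=
  fps_fun f m.

Lemma fpsP (A : Type) (n : nat) (f g : fps A n) :
  (forall m, fcoef m f = fcoef m g) -> f = g.
Proof. by case: f g => [f] [g] /= /funext fg; congr FPS. Qed.

HB.instance Definition _ (A : Type) (n : nat) := gen_eqMixin (fps A n).
HB.instance Definition _ (A : Type) (n : nat) := gen_choiceMixin (fps A n).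

Section FpsRing.
Variables (A : comNzRingType) (n : nat).
Implicit Types f g h : fps A n.

Definition fzero : fps A n := FPS (fun=> 0).
Definition fopp f : fps A n := FPS (fun m => - fcoef m f).
Definition fadd f g : fps A n := FPS (fun m => fcoef m f + fcoef m g).
Definition fone : fps A n := FPS (fun m => (m == 0%MM)%:R).
Definition fmul f g : fps A n :=
  FPS (fun m => \sum_(k : 'X_{1..n < (mdeg m).+1} | (bmnm k <= m)%MM)
                   fcoef k f * fcoef (m - k)%MM g).

Fact faddA : associative fadd.
Proof. by move=> f g h; apply: fpsP => m; rewrite /fcoef /= addrA. Qed.
Fact faddC : commutative fadd.
Proof. by move=> f g; apply: fpsP => m; rewrite /fcoef /= addrC. Qed.
Fact fadd0 : left_id fzero fadd.
Proof. by move=> f; apply: fpsP => m; rewrite /fcoef /= add0r. Qed.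
Fact faddN : left_inverse fzero fopp fadd.
Proof. by move=> f; apply: fpsP => m; rewrite /fcoef /= addNr. Qed.

HB.instance Definition _ :=
  GRing.isZmodule.Build (fps A n) faddA faddC fadd0 faddN.

Definition ftrunc (d : nat) f : {mpoly A[n]} :=
  \sum_(m : 'X_{1..n < d}) fcoef m f *: 'X_[m].

Lemma mcoeff_ftrunc d f (m : 'X_{1..n}) :
  (mdeg m < d)%N -> (ftrunc d f)@_m = fcoef m f.
Proof. by move=> md; rewrite /ftrunc (mcoeff_mpoly _ md). Qed.

Lemma fcoef_mul f g (m : 'X_{1..n}) d : (mdeg m < d)%N ->
  fcoef m (fmul f g) = (ftrunc d f * ftrunc d g)@_m.
Proof.
move=> md; rewrite (mcoeff_poly_mul_lin _ _ (ltnSn (mdeg m))).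
apply: eq_bigr => k km; rewrite !mcoeff_ftrunc //.
  by apply: leq_ltn_trans md; rewrite mdegB.
by apply: leq_ltn_trans md; rewrite -ltnS bmdeg.
Qed.

Lemma mcoeffM_eq (d : nat) (p p' q q' : {mpoly A[n]}) (m : 'X_{1..n}) :
  (forall k, (mdeg k < d)%N -> p@_k = p'@_k) ->
  (forall k, (mdeg k < d)%N -> q@_k = q'@_k) ->
  (mdeg m < d)%N -> (p * q)@_m = (p' * q')@_m.
Proof.
move=> pp qq md; rewrite !(mcoeff_poly_mul_lin _ _ (ltnSn (mdeg m))).
apply: eq_bigr => k km; rewrite pp ?qq //.
  by apply: leq_ltn_trans md; rewrite mdegB.
by apply: leq_ltn_trans md; rewrite -ltnS bmdeg.
Qed.

Lemma mcoeff_ftruncM d f g (m : 'X_{1..n}) : (mdeg m < d)%N ->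
  (ftrunc d (fmul f g))@_m = (ftrunc d f * ftrunc d g)@_m.
Proof. by move=> md; rewrite mcoeff_ftrunc ?(fcoef_mul _ _ md). Qed.

Fact fmulA : associative fmul.
Proof.
move=> f g h; apply: fpsP => m; set d := (mdeg m).+1.
have md : (mdeg m < d)%N by [].
rewrite !(fcoef_mul _ _ md).
rewrite (mcoeffM_eq (p' := ftrunc d f) (q' := ftrunc d g * ftrunc d h) _ _ md) //;
  last by move=> k; apply: mcoeff_ftruncM.
rewrite [RHS](mcoeffM_eq (p' := ftrunc d f * ftrunc d g) (q' := ftrunc d h) _ _ md) //;
  first by rewrite mulrA.
by move=> k; apply: mcoeff_ftruncM.
Qed.

Fact fmulC : commutative fmul.
Proof.
move=> f g; apply: fpsP => m.
by rewrite !(fcoef_mul _ _ (ltnSn (mdeg m))) mulrC.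
Qed.

Fact fmul1 : left_id fone fmul.
Proof.
move=> f; apply: fpsP => m; rewrite (fcoef_mul _ _ (ltnSn (mdeg m))).
rewrite (mcoeffM_eq (d := (mdeg m).+1) (p' := 1) (q' := ftrunc (mdeg m).+1 f)) //.
  by rewrite mul1r mcoeff_ftrunc.
by move=> k kd; rewrite mcoeff_ftrunc // mcoeff1.
Qed.

Fact fmulDl : left_distributive fmul fadd.
Proof.
move=> f g h; apply: fpsP => m; rewrite {2}/fcoef /= -big_split /=.
by apply: eq_bigr => k _; rewrite -mulrDl.
Qed.

Fact fone_neq0 : fone != 0 :> fps A n.
Proof.
apply/eqP => /(congr1 (fcoef 0%MM)); rewrite /fcoef /= eqxx => /eqP.
by rewrite oner_eq0.
Qed.

HB.instance Definition _ :=
  GRing.Zmodule_isComNzRing.Build (fps A n) fmulA fmulC fmul1 fmulDl fone_neq0.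

Definition fvar (i : 'I_n) : fps A n := FPS (fun m => (m == U_(i)%MM)%:R).

Definition fderiv (i : 'I_n) f : fps A n :=
  FPS (fun m => fcoef (m + U_(i))%MM f *+ (m i).+1).

End FpsRing.

Arguments fvar {A n} i.

Section FormalMaps.
Variable A : comNzRingType.

Definition fid (n : nat) : 'rV[fps A n]_n := \row_i fvar i.

Definition fzero_const (n p : nat) (F : 'rV[fps A n]_p) : Prop :=
  forall i, fcoef 0%MM (F 0 i) = 0.

(* [fsubst f G] is f(G(x)).  Since G^k only has terms of degree >= |k| when
   G(0) = 0, the coefficient of [m] only involves the exponents k with
   |k| <= |m|; the definition is meaningful only if [fzero_const G]. *)
Definition fsubst (n p : nat) (f : fps A p) (G : 'rV[fps A n]_p) : fps A n :=
  FPS (fun m => \sum_(k : 'X_{1..p < (mdeg m).+1})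
         fcoef k f * fcoef m (\prod_(i < p) G 0 i ^+ bmnm k i)).

Definition fcomp (n p q : nat) (F : 'rV[fps A p]_q) (G : 'rV[fps A n]_p) :
  'rV[fps A n]_q := map_mx (fun f => fsubst f G) F.

Definition jacobian_mx (n p : nat) (F : 'rV[fps A n]_p) : 'M[fps A n]_(p, n) :=
  \matrix_(i, j) fderiv j (F 0 i).

Definition Jac (n : nat) (H : 'rV[fps A n]_n) : fps A n :=
  \det (jacobian_mx H).

Definition differential0 (n p : nat) (F : 'rV[fps A n]_p) : 'M[A]_(p, n) :=
  map_mx (fcoef 0%MM) (jacobian_mx F).

(* Row and column selections that are not injective give zero minors. *)
Definition generic_rank (n p : nat) (F : 'rV[fps A n]_p) : nat :=
  \max_(r < (minn p n).+1 |
          [exists f : {ffun 'I_r -> 'I_p}, exists g : {ffun 'I_r -> 'I_n},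
             \det (mxsub f g (jacobian_mx F)) != 0]) r.

Definition formal_coordinate_change (n p : nat) (F : 'rV[fps A n]_p) : Prop :=
  fzero_const F /\
  exists G : 'rV[fps A p]_n,
    [/\ fzero_const G, fcomp F G = fid p & fcomp G F = fid n].

Definition in_ideal (n : nat) (r f : fps A n) : Prop := exists a, f = a * r.

End FormalMaps.

Section Hypersurfaces.
Variable R : realType.
Local Notation C := (R[i]).

Definition fconj (n : nat) (f : fps C n) : fps C n :=
  FPS (fun m => (fcoef m f)^*).

Definition fmap_conj (n p : nat) (F : 'rV[fps C n]_p) : 'rV[fps C n]_p :=
  map_mx (@fconj n) F.

(* In C[[Z, zeta]] = [fps C (N + N)], the block [lsubmx (fid _)] is Z and the
   block [rsubmx (fid _)] is zeta.  [fpolar F] is the complexified map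
   (x, y) |-> (F(x), \bar F(y)). *)
Definition fpolar (n p : nat) (F : 'rV[fps C n]_p) :
    'rV[fps C (n + n)]_(p + p) :=
  row_mx (fcomp F (lsubmx (fid C (n + n))))
         (fcomp (fmap_conj F) (rsubmx (fid C (n + n)))).

Definition dZ0 (N : nat) (r : fps C (N + N)) : 'rV[C]_N :=
  \row_j fcoef 0%MM (fderiv (lshift N j) r).

Record formal_hypersurface (N : nat) := FormalHypersurface {
  defining :> fps C (N + N);
  defining_real :
    fsubst (fconj defining)
      (row_mx (rsubmx (fid C (N + N))) (lsubmx (fid C (N + N)))) = defining;
  defining_at0 : fcoef 0%MM defining = 0;
  defining_dZ0 : dZ0 defining != 0
}.

(* Normal coordinates live in C^(N.-1 + 1), with the block z of size N.-1 and
   the last variable w; the variables of Q are ordered as (z, (chi, tau)). *)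
Section NormalCoordinates.
Variable N : nat.
Local Notation n := N.-1.

(* The series w - Q(z, chi, tau) in C[[(z, w), (chi, tau)]]. *)
Definition normal_equation (Q : fps C (n + (n + 1))) :
    fps C ((n + 1) + (n + 1)) :=
  let zw := lsubmx (fid C ((n + 1) + (n + 1))) in
  let chitau := rsubmx (fid C ((n + 1) + (n + 1))) in
  rsubmx zw 0 0 - fsubst Q (row_mx (lsubmx zw) chitau).

Definition normalized (Q : fps C (n + (n + 1))) : Prop :=
  let x := fid C (n + 1) in
  fsubst Q (row_mx 0 x) = rsubmx x 0 0 /\
  fsubst Q (row_mx (lsubmx x) (row_mx 0 (rsubmx x))) = rsubmx x 0 0.

Definition normal_coordinates (M : formal_hypersurface N)
    (Z : 'rV[fps C (n + 1)]_N) (Q : fps C (n + (n + 1))) : Prop :=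
  [/\ formal_coordinate_change Z, normalized Q
    & forall f, in_ideal (fsubst M (fpolar Z)) f <->
                in_ideal (normal_equation Q) f].

(* Q_{z^alpha}(z, chi, tau) *)
Definition zderiv (alpha : 'X_{1..n}) (Q : fps C (n + (n + 1))) :
    fps C (n + (n + 1)) :=
  foldr (fun i f => iter (alpha i) (fderiv (lshift (n + 1) i)) f) Q
        (enum 'I_n).

(* The map chi |-> (Q_{z^alpha}(0, chi, 0))_{|alpha| <= k}. *)
Definition zderiv_map (Q : fps C (n + (n + 1))) (k : nat) :
    'rV[fps C n]_#|{: 'X_{1..n < k.+1}}| :=
  \row_a fsubst (zderiv (bmnm (enum_val a)) Q)
                (row_mx 0 (row_mx (fid C n) 0)).

Definition class_C (M : formal_hypersurface N) : Prop :=
  exists (Z : 'rV[fps C (n + 1)]_N) (Q : fps C (n + (n + 1))),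
    normal_coordinates M Z Q /\
    exists k0 : nat, forall k : nat, (k0 <= k)%N ->
      generic_rank (zderiv_map Q k) = n.

End NormalCoordinates.

Definition sends_into (N : nat) (H : 'rV[fps C N]_N)
    (M M' : formal_hypersurface N) : Prop :=
  in_ideal M (fsubst M' (fpolar H)).

(* Row spaces: a tangent vector v is a row, on which a linear map with matrix
   [L] acts by v *m L^T. *)
Definition T10 (N : nat) (M : formal_hypersurface N) : 'M[C]_N :=
  kermx (dZ0 M)^T.

Definition CR_transversal (N : nat) (H : 'rV[fps C N]_N)
    (M' : formal_hypersurface N) : Prop :=
  (T10 M' + (differential0 H)^T :=: 1%:M)%MS.

End Hypersurfaces.

(* Main.v *)
(* In normal coordinates (z, w) for M, complexify: with r' defining M', the
   series r'(H(x), \bar H(y)) equals a * (w - Q(z, chi, tau)), and H is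
   CR-transversal iff a(0) <> 0.  Restrict to the first Segre set
   (z, q(z, chi), chi, 0), where q(z, chi) = Q(z, chi, 0), and let lam(z, chi)
   be the restriction of a.  Differentiating in x shows that lam <> 0, since
   otherwise the gradient of r' would annihilate the Jacobian matrix of H along
   a generically submersive map.  Differentiating in y gives
     l(z, chi) * J(chi) = - lam(z, chi) * (Q_chi, Q_tau)(z, chi, 0)
   with J the Jacobian matrix of \bar H at (chi, 0) and l(0) <> 0.  Since M is
   of class C, no nonzero vector depending on chi only is annihilated by
   (Q_chi, Q_tau)(z, chi, 0), so D(chi) = det J(chi) is nonzero and lam divides
   unit * D(chi).  By reality lam(z, 0) is, up to sign and conjugation,
   lam(0, chi), hence nonzero, and a divisor of unit * D(chi) that does not
   vanish identically on chi = 0 must be a unit. *)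

Require Import Defs.
From HB Require Import structures.
From mathcomp Require Import all_boot all_order all_algebra.
From mathcomp Require Import boolp reals complex mpoly.

Set Implicit Arguments.
Unset Strict Implicit.
Unset Printing Implicit Defensive.

Import GRing.Theory Num.Theory.
Local Open Scope ring_scope.

(** * Coefficients, truncation and derivations *)

Local Arguments fcoef {A n} m f : simpl never.

Section Coefficients.
Variables (A : comNzRingType) (n : nat).
Implicit Types f g : fps A n.

Lemma fcoef_is_zmod_morphism (m : 'X_{1..n}) :
  zmod_morphism (fcoef m : fps A n -> A).
Proof. by []. Qed.

HB.instance Definition _ (m : 'X_{1..n}) :=
  GRing.isZmodMorphism.Build (fps A n) A (fcoef m)
    (fcoef_is_zmod_morphism m).

Lemma fcoef1 (m : 'X_{1..n}) : fcoef m (1 : fps A n) = (m == 0%MM)%:R.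
Proof. by []. Qed.

Lemma fcoefM f g (m : 'X_{1..n}) : fcoef m (f * g) =
  \sum_(k : 'X_{1..n < (mdeg m).+1} | (bmnm k <= m)%MM)
     fcoef k f * fcoef (m - k)%MM g.
Proof. by []. Qed.

Lemma fcoef_fderiv i f (m : 'X_{1..n}) :
  fcoef m (fderiv i f) = fcoef (m + U_(i))%MM f *+ (m i).+1.
Proof. by []. Qed.

(** Congruence modulo the [d]-th power of the ideal of the variables. Identities between series are
    proved modulo every [d], where truncation turns them into polynomial identities. *)
Definition feq_upto d f g :=
  forall m : 'X_{1..n}, (mdeg m < d)%N -> fcoef m f = fcoef m g.

Lemma feq_uptoP f g : (forall d, feq_upto d f g) -> f = g.
Proof. by move=> fg; apply: fpsP => m; apply: (fg (mdeg m).+1). Qed.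

Lemma feq_uptoM d f f' g g' :
  feq_upto d f f' -> feq_upto d g g' -> feq_upto d (f * g) (f' * g').
Proof.
move=> ff gg m md; rewrite !fcoefM; apply: eq_bigr => k km.
rewrite ff ?gg //; first by apply: leq_ltn_trans md; rewrite mdegB.
by apply: leq_ltn_trans md; rewrite -ltnS bmdeg.
Qed.

Lemma feq_upto_sum d (I : Type) (r : seq I) (F G : I -> fps A n) :
  (forall i, feq_upto d (F i) (G i)) ->
  feq_upto d (\sum_(i <- r) F i) (\sum_(i <- r) G i).
Proof. by move=> FG m md; rewrite !raddf_sum; apply: eq_bigr => i _;
  apply: FG. Qed.

Lemma feq_upto_deriv d i f g :
  feq_upto d.+1 f g -> feq_upto d (fderiv i f) (fderiv i g).
Proof.
by move=> fg m md; rewrite /fcoef /= fg // mdegD mdeg1 addn1.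
Qed.

Definition fps_of_mpoly (p : {mpoly A[n]}) : fps A n := FPS (fun m => p@_m).

Lemma fps_of_mpoly_is_zmod_morphism : zmod_morphism fps_of_mpoly.
Proof. by move=> p q; apply: fpsP => m; rewrite raddfB /fcoef /= mcoeffB. Qed.

HB.instance Definition _ :=
  GRing.isZmodMorphism.Build {mpoly A[n]} (fps A n) fps_of_mpoly
    fps_of_mpoly_is_zmod_morphism.

Lemma fps_of_mpoly_is_monoid_morphism : monoid_morphism fps_of_mpoly.
Proof.
split; first by apply: fpsP => m; rewrite /fcoef /= mcoeff1.
move=> p q; apply: fpsP => m; rewrite fcoefM {1}/fcoef /=.
by rewrite (mcoeff_poly_mul_lin _ _ (ltnSn (mdeg m))).
Qed.

HB.instance Definition _ :=
  GRing.isMonoidMorphism.Build {mpoly A[n]} (fps A n) fps_of_mpoly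
    fps_of_mpoly_is_monoid_morphism.

Lemma feq_upto_trunc d f : feq_upto d f (fps_of_mpoly (ftrunc d f)).
Proof. by move=> m md; rewrite [RHS]/fcoef /= mcoeff_ftrunc. Qed.

Lemma fderiv_is_zmod_morphism i : zmod_morphism (@fderiv A n i).
Proof. by move=> f g; apply: fpsP => m; rewrite raddfB /fcoef /= mulrnBl. Qed.

HB.instance Definition _ i :=
  GRing.isZmodMorphism.Build (fps A n) (fps A n) (@fderiv A n i)
    (fderiv_is_zmod_morphism i).

Lemma fderiv_mpoly i (p : {mpoly A[n]}) :
  fderiv i (fps_of_mpoly p) = fps_of_mpoly p^`M(i).
Proof. by apply: fpsP => m; rewrite /fcoef /= mcoeff_deriv. Qed.

(** Leibniz for polynomials is transferred by truncation. The truncation is at [d.+1] because a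
    derivation loses one order of agreement. *)
Lemma fderivM i f g : fderiv i (f * g) = fderiv i f * g + f * fderiv i g.
Proof.
apply: feq_uptoP => d; set p := ftrunc d.+1 f; set q := ftrunc d.+1 g.
have fp := feq_upto_trunc (d := d.+1) f;
  have gq := feq_upto_trunc (d := d.+1) g.
have weak h h' : feq_upto d.+1 h h' -> feq_upto d h h'.
  by move=> hh m md; apply: hh; apply: ltnW.
have polyM : fderiv i (fps_of_mpoly p * fps_of_mpoly q) =
    fderiv i (fps_of_mpoly p) * fps_of_mpoly q +
    fps_of_mpoly p * fderiv i (fps_of_mpoly q).
  by rewrite !fderiv_mpoly -!rmorphM fderiv_mpoly mderivM rmorphD.
move=> m md; rewrite (feq_upto_deriv i (feq_uptoM fp gq)) // polyM !raddfD.
congr (_ + _); symmetry.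
  by apply: feq_uptoM md; [apply: feq_upto_deriv | apply: weak].
by apply: feq_uptoM md; [apply: weak | apply: feq_upto_deriv].
Qed.

Lemma fderivC i j f : fderiv i (fderiv j f) = fderiv j (fderiv i f).
Proof.
apply: fpsP => m; rewrite /fcoef /= -!mulrnA !mnmDE !mnm1E.
have -> : (m + U_(i) + U_(j) = m + U_(j) + U_(i))%MM.
  by rewrite -!addmA (addmC U_(i)%MM).
rewrite eq_sym; case: eqVneq => [->|_] //=.
by rewrite !addn0 mulnC.
Qed.

Lemma fderiv_var i j : fderiv i (fvar j : fps A n) = (i == j)%:R.
Proof.
apply: fpsP => m; rewrite -[RHS](_ : (i == j)%:R * (m == 0%MM)%:R = _);
  last first.
  by case: (i == j); rewrite ?mul1r // ?mul0r // raddf0.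
rewrite /fcoef /= /fcoef /=.
case: (eqVneq i j) => [<-|ij]; last first.
  case: eqP => [/mnmP/(_ i)|_]; last by rewrite mul0rn mul0r.
  by rewrite mnmDE !mnm1E eqxx eq_sym (negbTE ij) addn1.
rewrite mul1r -{2}[U_(i)%MM]add0m eqm_add2r.
by case: eqP => [->|_]; rewrite ?mul0rn // mnm0E.
Qed.

Lemma fderiv1 i : fderiv i (1 : fps A n) = 0.
Proof.
by have := fderivM i 1 1; rewrite !mulr1 mul1r => /eqP;
  rewrite -subr_eq subrr => /eqP.
Qed.

Definition fconst (c : A) : fps A n := fps_of_mpoly c%:MP.

Lemma fconst_is_zmod_morphism : zmod_morphism fconst.
Proof. by move=> c d; rewrite /fconst !raddfB. Qed.
HB.instance Definition _ :=
  GRing.isZmodMorphism.Build A (fps A n) fconst fconst_is_zmod_morphism.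
Lemma fconst_is_monoid_morphism : monoid_morphism fconst.
Proof. by split=> [|c d]; rewrite /fconst ?rmorph1 // !rmorphM. Qed.
HB.instance Definition _ :=
  GRing.isMonoidMorphism.Build A (fps A n) fconst fconst_is_monoid_morphism.

Lemma fcoef_fconstM c f (m : 'X_{1..n}) : fcoef m (fconst c * f) = c * fcoef m
  f.
Proof.
have cc : feq_upto (mdeg m).+1 (fconst c) (fconst c) by [].
rewrite (feq_uptoM cc (@feq_upto_trunc _ f) (ltnSn _)).
by rewrite /fconst -rmorphM {1}/fcoef /= mcoeffCM mcoeff_ftrunc.
Qed.

Lemma fderiv_fconst i c : fderiv i (fconst c) = 0.
Proof. by rewrite fderiv_mpoly mderivC raddf0. Qed.

Lemma fcoef0M f g : fcoef 0%MM (f * g) = fcoef 0%MM f * fcoef 0%MM g.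
Proof.
rewrite (feq_uptoM (@feq_upto_trunc 1 f) (@feq_upto_trunc 1 g)) ?mdeg0 //.
by rewrite -rmorphM [LHS]/fcoef /= rmorphM /= !mcoeff_ftrunc ?mdeg0.
Qed.

Lemma fcoef0_is_monoid_morphism :
  monoid_morphism (fcoef 0%MM : fps A n -> A).
Proof. by split; [rewrite fcoef1 eqxx | exact: fcoef0M]. Qed.

HB.instance Definition _ :=
  GRing.isMonoidMorphism.Build (fps A n) A (fcoef 0%MM)
    fcoef0_is_monoid_morphism.

Definition forder_ge d f := forall m : 'X_{1..n},
  (mdeg m < d)%N -> fcoef m f = 0.

Lemma forder_geM d e f g :
  forder_ge d f -> forder_ge e g -> forder_ge (d + e) (f * g).
Proof.
move=> fd ge m md; rewrite fcoefM big1 // => k km.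
have [kd|kd] := ltnP (mdeg (bmnm k)) d; first by rewrite fd // mul0r.
rewrite ge ?mulr0 //; rewrite -(ltn_add2l (mdeg (bmnm k))) -mdegD addmC submK
  //.
by apply: leq_trans md _; rewrite leq_add2r.
Qed.

Lemma forder_ge1P f : fcoef 0%MM f = 0 -> forder_ge 1 f.
Proof. by move=> f0 m; rewrite ltnS leqn0 mdeg_eq0 => /eqP ->. Qed.

Lemma forder_ge_exp f k : fcoef 0%MM f = 0 -> forder_ge k (f ^+ k).
Proof.
move=> /forder_ge1P f1; elim: k => [|k IH] // ; rewrite exprS -add1n.
exact: forder_geM.
Qed.

End Coefficients.

(** * Substitution *)

Section Substitution.
Variables (A : comNzRingType) (n p : nat) (G : 'rV[fps A n]_p).
Hypothesis G0 : fzero_const G.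
Implicit Types f g : fps A p.

(** Substitution into polynomials is already a ring morphism; [fsubst] agrees with it on truncations
    and inherits its algebraic properties. *)
Let ev : {mpoly A[p]} -> fps A n := mmap (@fconst A n) (fun i => G 0 i).

Let order_mon (k : 'X_{1..p}) : forder_ge (mdeg k) (mmap1 (fun i => G 0 i) k).
Proof.
rewrite mdegE /mmap1; elim/big_rec2: _ => [|i f d _ IH] //.
by apply: forder_geM => //; apply: forder_ge_exp; apply: G0.
Qed.

(** Since [G] has no constant term, the monomial of exponent [k] in [G] has order at least [mdeg k],
    so terms of degree [d] and more cannot contribute below degree [d]. *)
Let ev_upto d (P P' : {mpoly A[p]}) :
  (forall k, (mdeg k < d)%N -> P@_k = P'@_k) -> feq_upto d (ev P) (ev P').
Proof.
move=> PP m md; apply/eqP; rewrite -subr_eq0 -!raddfB /ev /mmap.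
rewrite raddf_sum /= big_seq big1 // => k; rewrite mcoeff_msupp => kP.
rewrite fcoef_fconstM order_mon ?mulr0 //; apply: leq_trans md _.
by rewrite leqNgt; apply: contra kP => kd; rewrite mcoeffB PP // subrr.
Qed.

Let fsubst_ev d f : feq_upto d (fsubst f G) (ev (ftrunc d f)).
Proof.
move=> m md.
rewrite -(@ev_upto (mdeg m).+1 (ftrunc (mdeg m).+1 f)) //; last first.
  move=> k km; rewrite !mcoeff_ftrunc //.
  by apply: leq_trans md; rewrite -ltnS.
rewrite {1}/fcoef /= /ev /ftrunc (raddf_sum (mmap _ _)) raddf_sum /=;
  apply: eq_bigr => k _.
by rewrite mmapZ mmapX fcoef_fconstM.
Qed.

Lemma feq_upto_fsubst d f f' :
  feq_upto d f f' -> feq_upto d (fsubst f G) (fsubst f' G).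
Proof.
move=> ff m md; rewrite !(fsubst_ev _ md); apply: ev_upto md => k kd.
by rewrite !mcoeff_ftrunc // ff.
Qed.

Lemma fsubst_mpoly (P : {mpoly A[p]}) :
  fsubst (fps_of_mpoly P) G = mmap (@fconst A n) (fun i => G 0 i) P.
Proof.
apply: feq_uptoP => d m md; rewrite (fsubst_ev _ md); apply: ev_upto md => k kd.
by rewrite mcoeff_ftrunc.
Qed.

Lemma fsubst_is_zmod_morphism : zmod_morphism (fun f => fsubst f G).
Proof.
move=> f g; apply: feq_uptoP => d m md.
have ff := @feq_upto_trunc _ _ d f; have gg := @feq_upto_trunc _ _ d g.
rewrite (feq_upto_fsubst (f' := fps_of_mpoly (ftrunc d f - ftrunc d g)) _ md).
  rewrite fsubst_mpoly (raddfB (mmap _ _)) /= -!fsubst_mpoly !(raddfB (fcoef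
    m)); congr (_ - _); symmetry.
    exact: feq_upto_fsubst md.
  exact: feq_upto_fsubst md.
by move=> k kd; rewrite !raddfB /= (ff _ kd) (gg _ kd).
Qed.

Lemma fsubst_is_monoid_morphism : monoid_morphism (fun f => fsubst f G).
Proof.
split=> [|f g]; first by rewrite -(rmorph1 (@fps_of_mpoly A p)) fsubst_mpoly
  rmorph1.
apply: feq_uptoP => d m md.
have ff := @feq_upto_trunc _ _ d f; have gg := @feq_upto_trunc _ _ d g.
rewrite (feq_upto_fsubst (f' := fps_of_mpoly (ftrunc d f * ftrunc d g)) _ md).
  rewrite fsubst_mpoly (rmorphM (mmap _ _)) /= -!fsubst_mpoly; symmetry.
  by apply: feq_uptoM md; apply: feq_upto_fsubst.
by rewrite rmorphM; apply: feq_uptoM.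
Qed.

(** The proof of [fzero_const G] is kept as an argument so that the ring morphism structure, which
    depends on it, can be attached to a named function and used by [map_mx]. *)
Definition fsubst_at (_ : fzero_const G) f := fsubst f G.

HB.instance Definition _ :=
  GRing.isZmodMorphism.Build (fps A p) (fps A n) (fsubst_at G0)
    fsubst_is_zmod_morphism.
HB.instance Definition _ :=
  GRing.isMonoidMorphism.Build (fps A p) (fps A n) (fsubst_at G0)
    fsubst_is_monoid_morphism.

Lemma fsubst0 : fsubst 0 G = 0.
Proof. exact: (raddf0 (fsubst_at G0)). Qed.

Lemma fsubst1 : fsubst 1 G = 1.
Proof. exact: (rmorph1 (fsubst_at G0)). Qed.

Lemma fsubstD f g : fsubst (f + g) G = fsubst f G + fsubst g G.
Proof. exact: (raddfD (fsubst_at G0)). Qed.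

Lemma fsubstN f : fsubst (- f) G = - fsubst f G.
Proof. exact: (raddfN (fsubst_at G0)). Qed.

Lemma fsubstM f g : fsubst (f * g) G = fsubst f G * fsubst g G.
Proof. exact: (rmorphM (fsubst_at G0)). Qed.

Lemma fsubst_sum (I : Type) (r : seq I) (F : I -> fps A p) :
  fsubst (\sum_(i <- r) F i) G = \sum_(i <- r) fsubst (F i) G.
Proof. exact: (raddf_sum (fsubst_at G0)). Qed.

Lemma fsubst_var i : fsubst (fvar i) G = G 0 i.
Proof.
have -> : fvar i = fps_of_mpoly 'X_i :> fps A p.
  by apply: fpsP => m; rewrite /fcoef /= mcoeffX eq_sym.
by rewrite fsubst_mpoly mmapX mmap1U.
Qed.

Lemma fsubst_fconst c : fsubst (fconst _ c) G = fconst _ c.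
Proof. by rewrite fsubst_mpoly mmapC. Qed.

Lemma fcoef0_fsubst f : fcoef 0%MM (fsubst f G) = fcoef 0%MM f.
Proof.
have f1 := @feq_upto_trunc _ _ 1 f.
rewrite (feq_upto_fsubst f1) ?mdeg0 // fsubst_mpoly f1 ?mdeg0 //.
rewrite /fcoef /= -/(fcoef _ _); move: (ftrunc 1 f) => P.
rewrite {2}(mpolyE P) /mmap !raddf_sum; apply: eq_bigr => k _ /=.
rewrite fcoef_fconstM mcoeffZ mcoeffX; congr (_ * _).
case: (eqVneq k 0%MM) => [->|k0]; first by rewrite mmap11 fcoef1 eqxx.
by rewrite order_mon // mdeg0 lt0n mdeg_eq0.
Qed.

(** The chain rule is checked on polynomials, by linearity on single monomials, and then passes to
    series by truncation at one order higher. *)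
Lemma fderiv_fsubst j f : fderiv j (fsubst f G) =
  \sum_i fsubst (fderiv i f) G * fderiv j (G 0 i).
Proof.
have poly_case (P : {mpoly A[p]}) :
    fderiv j (ev P) = \sum_i ev (mderiv i P) * fderiv j (G 0 i).
  rewrite /ev; elim/mpolyind: P => [|c k P _ _ IH].
    by rewrite !raddf0 big1 // => i _; rewrite !raddf0 mul0r.
  rewrite mmapD raddfD /= IH; under [RHS]eq_bigr => i _ do
    rewrite mderivD mmapD mulrDl /=.
  rewrite big_split; congr (_ + _) => {P IH} /=.
  rewrite !mmapZ fderivM fderiv_fconst mul0r add0r mmapX.
  under eq_bigr => i _ do rewrite mderivZ mderivX !mmapZ mmapX -mulrA.
  rewrite -mulr_sumr; congr (_ * _); rewrite /mmap1.
  (* Leibniz rule for a product over a duplicate-free list; uniqueness makes the omitted factor of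
     each term well determined. *)
  have D (r : seq 'I_p) : uniq r -> fderiv j (\prod_(i <- r) G 0 i ^+ k i) =
      \sum_(i <- r) fderiv j (G 0 i ^+ k i) *
        \prod_(i' <- r | i' != i) G 0 i' ^+ k i'.
    elim: r => [|i r IH] /=; first by rewrite !big_nil fderiv1.
    case/andP=> ir ur; rewrite !big_cons fderivM IH // eqxx /=; congr (_ + _).
      congr (_ * _); rewrite big_seq [RHS]big_seq_cond; apply: eq_bigl => i'.
      by case: (boolP (i' \in r)) => //= i'r; rewrite (memPn ir).
    rewrite mulr_sumr !big_seq; apply: eq_bigr => i' i'r.
    rewrite big_cons mulrCA ifT //; apply: contraNneq ir => ->//.
  rewrite D ?index_enum_uniq //.
  apply: eq_bigr => i _; rewrite [X in _ = _ * X * _](bigD1 i) //= mnmBE mnm1E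
    eqxx subn1.
  under [in RHS]eq_bigr => i' ii do
    rewrite mnmBE mnm1E eq_sym (negbTE ii) subn0.
  rewrite !mulrA [RHS]mulrAC; congr (_ * _).
  (* Power rule. Exponent 0 is separate: its predecessor is again 0, and the factor [0%:R] kills the
     right side. *)
  rewrite rmorph_nat; case: (k i) => [|e].
    by rewrite expr0 fderiv1 !mul0r.
  rewrite succnK; elim: e => [|e IH]; first by rewrite !expr1 expr0 mulr1 mul1r.
  rewrite [G 0 i ^+ e.+2]exprS fderivM IH [e.+2%:R]mulrS !mulrDl mul1r mulrC.
  by congr (_ + _); rewrite exprS !mulrA [G 0 i * _]mulrC.
apply: feq_uptoP => d m md.
have f1 := @feq_upto_trunc _ _ d.+1 f.
rewrite (feq_upto_deriv j (feq_upto_fsubst f1)) // fsubst_mpoly poly_case.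
apply: feq_upto_sum md => i; rewrite /ev -fsubst_mpoly -fderiv_mpoly.
apply: feq_uptoM => //; apply: feq_upto_fsubst => k kd; symmetry.
exact: feq_upto_deriv kd.
Qed.

End Substitution.

(** * Composition of formal maps and its compatibility with blocks of variables *)

Section Composition.
Variable A : comNzRingType.

Lemma fps_of_mpolyE n (P : {mpoly A[n]}) :
  mmap (@fconst A n) fvar P = fps_of_mpoly P.
Proof.
elim/mpolyind: P => [|c k P _ _ IH]; first by rewrite !raddf0.
rewrite mmapD raddfD /= IH; congr (_ + _).
rewrite mmapZ mmapX -mul_mpolyC rmorphM; congr (_ * _).
rewrite mpolyXE_id rmorph_prod; apply: eq_bigr => i _; rewrite rmorphXn /=.
by congr (_ ^+ _); apply: fpsP => m; rewrite /fcoef /= mcoeffX eq_sym.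
Qed.

Lemma fzero_const_fid n : fzero_const (fid A n).
Proof. by move=> i; rewrite mxE /fcoef /= eq_sym mnm1_eq0. Qed.

Lemma fsubst_fid n (f : fps A n) : fsubst f (fid A n) = f.
Proof.
apply: feq_uptoP => d m md; have f1 := @feq_upto_trunc _ _ d f.
rewrite (feq_upto_fsubst (@fzero_const_fid n) f1) // f1 // fsubst_mpoly;
  last first.
  exact: fzero_const_fid.
by rewrite -fps_of_mpolyE; congr (fcoef _ (mmap _ _ _)); apply/funext => i;
  rewrite mxE.
Qed.

Lemma fzero_const_comp n p q (F : 'rV[fps A p]_q) (G : 'rV[fps A n]_p) :
  fzero_const F -> fzero_const G -> fzero_const (fcomp F G).
Proof. by move=> F0 G0 i; rewrite mxE fcoef0_fsubst. Qed.

(** Modulo degree [d] the series [f] may be replaced by a polynomial, and substituting [G] is a ring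
    morphism, so it passes through the monomials in [F]. *)
Lemma fsubstA n p q (f : fps A q) (F : 'rV[fps A p]_q) (G : 'rV[fps A n]_p) :
  fzero_const F -> fzero_const G ->
  fsubst (fsubst f F) G = fsubst f (fcomp F G).
Proof.
move=> F0 G0; have FG0 := fzero_const_comp F0 G0.
apply: feq_uptoP => d m md; have f1 := @feq_upto_trunc _ _ d f.
rewrite (feq_upto_fsubst G0 (feq_upto_fsubst F0 f1)) //.
rewrite (feq_upto_fsubst FG0 f1) // !fsubst_mpoly //; congr (fcoef m _).
rewrite -[LHS]/(fsubst_at G0 _) /mmap raddf_sum; apply: eq_bigr => k _ /=.
rewrite rmorphM rmorph_prod /=; congr (_ * _); first exact: fsubst_fconst.
by apply: eq_bigr => i _; rewrite rmorphXn /= mxE.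
Qed.

Lemma fsubst_entry n p q (F : 'rV[fps A p]_q) (G : 'rV[fps A n]_p) j :
  fsubst (F 0 j) G = fcomp F G 0 j.
Proof. by rewrite mxE. Qed.

Lemma fcompA n p q r (F : 'rV[fps A q]_r) (G : 'rV[fps A p]_q)
    (H : 'rV[fps A n]_p) : fzero_const G -> fzero_const H ->
  fcomp (fcomp F G) H = fcomp F (fcomp G H).
Proof. by move=> G0 H0; apply/rowP => i; rewrite !mxE fsubstA. Qed.

Lemma fid_comp n p (G : 'rV[fps A n]_p) :
  fzero_const G -> fcomp (fid A p) G = G.
Proof. by move=> G0; apply/rowP => i; rewrite !mxE fsubst_var. Qed.

Lemma fcomp0 n p q (G : 'rV[fps A n]_p) :
  fzero_const G -> fcomp (0 : 'rV_q) G = 0.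
Proof. by move=> G0; apply/rowP => i; rewrite !mxE fsubst0. Qed.

Lemma fcomp_row_mx n p q r (F : 'rV[fps A p]_q) (F' : 'rV[fps A p]_r)
    (G : 'rV[fps A n]_p) :
  fcomp (row_mx F F') G = row_mx (fcomp F G) (fcomp F' G).
Proof. exact: map_row_mx. Qed.

Lemma fcomp_lsubmx n p q r (F : 'rV[fps A p]_(q + r)) (G : 'rV[fps A n]_p) :
  fcomp (lsubmx F) G = lsubmx (fcomp F G).
Proof. exact: map_lsubmx. Qed.

Lemma fcomp_rsubmx n p q r (F : 'rV[fps A p]_(q + r)) (G : 'rV[fps A n]_p) :
  fcomp (rsubmx F) G = rsubmx (fcomp F G).
Proof. exact: map_rsubmx. Qed.

Lemma fzero_const0 n p : fzero_const (0 : 'rV[fps A n]_p).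
Proof. by move=> i; rewrite mxE. Qed.

Lemma fzero_const_row_mx n p q (F : 'rV[fps A n]_p) (G : 'rV[fps A n]_q) :
  fzero_const F -> fzero_const G -> fzero_const (row_mx F G).
Proof. by move=> F0 G0 i; rewrite mxE; case: split. Qed.

Lemma fzero_const_lsubmx n p q (F : 'rV[fps A n]_(p + q)) :
  fzero_const F -> fzero_const (lsubmx F).
Proof. by move=> F0 i; rewrite mxE. Qed.

Lemma fzero_const_rsubmx n p q (F : 'rV[fps A n]_(p + q)) :
  fzero_const F -> fzero_const (rsubmx F).
Proof. by move=> F0 i; rewrite mxE. Qed.

End Composition.

Lemma fzero_const_conj (R : realType) n p (F : 'rV[fps R[i] n]_p) :
  fzero_const F -> fzero_const (fmap_conj F).
Proof. by move=> F0 i; rewrite mxE [LHS](congr1 Num.conj (F0 i)) rmorph0. Qed.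

(* Purely syntactic: comparing distinct formal maps up to conversion, as [done]
   does, can take minutes. *)
Ltac fzero :=
  match goal with
  | H : fzero_const ?F |- fzero_const ?F => exact H
  | |- fzero_const (fid _ _) => exact: fzero_const_fid
  | |- fzero_const 0 => exact: fzero_const0
  | |- fzero_const (row_mx _ _) => apply: fzero_const_row_mx; fzero
  | |- fzero_const (lsubmx _) => apply: fzero_const_lsubmx; fzero
  | |- fzero_const (rsubmx _) => apply: fzero_const_rsubmx; fzero
  | |- fzero_const (fcomp _ _) => apply: fzero_const_comp; fzero
  | |- fzero_const (fmap_conj _) => apply: fzero_const_conj; fzero
  end.

Section MatrixComposition.
Variable A : comNzRingType.

Lemma fsubst_rfidK p q (f : fps A q) :
  fsubst (fsubst f (rsubmx (fid A (p + q)))) (row_mx 0 (fid A q)) = f.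
Proof.
rewrite fsubstA; try fzero.
by rewrite fcomp_rsubmx fid_comp; [rewrite row_mxKr fsubst_fid | fzero].
Qed.

Lemma jacobian_mx_comp n p q (F : 'rV[fps A p]_q) (G : 'rV[fps A n]_p)
    (G0 : fzero_const G) :
  jacobian_mx (fcomp F G) =
    map_mx (fsubst_at G0) (jacobian_mx F) *m jacobian_mx G.
Proof.
apply/matrixP => i j; rewrite !mxE fderiv_fsubst //.
by apply: eq_bigr => k _; rewrite !mxE.
Qed.

Lemma jacobian_mx_fid n : jacobian_mx (fid A n) = 1%:M.
Proof. by apply/matrixP => i j; rewrite !mxE fderiv_var eq_sym. Qed.

End MatrixComposition.

(** * Leading monomials *)

Section LeadingMonomial.
Variables (A : idomainType) (n : nat) (wt : 'X_{1..n} -> nat).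
Hypothesis wtD : forall a b, wt (a + b)%MM = (wt a + wt b)%N.
Implicit Types f g : fps A n.

(** A monomial order with the weight compared first and the standard order on monomials breaking
    ties. For series the leading monomial is the smallest one, since there need be no largest. *)
Definition wle (a b : 'X_{1..n}) :=
  (wt a < wt b)%N || (wt a == wt b) && (a <= b)%O.

Let wle_wt a b : wle a b -> (wt a <= wt b)%N.
Proof. by case/orP=> [/ltnW|/andP[/eqP->]]. Qed.

Lemma wle_anti a b : wle a b -> wle b a -> a = b.
Proof.
move=> ab ba; have := wle_wt ab; have := wle_wt ba.
case/orP: ab => [|/andP[_ ab]]; first by rewrite ltnNge => /negP.
case/orP: ba => [|/andP[_ ba]]; first by rewrite ltnNge => /negP.
by move=> _ _; apply: Order.POrderTheory.le_anti; rewrite ab.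
Qed.

Lemma wleD a a' b b' : wle a a' -> wle b b' -> wle (a + b)%MM (a' + b')%MM.
Proof.
rewrite /wle !wtD => /orP[aa|/andP[/eqP -> aa]] /orP[bb|/andP[/eqP -> bb]].
- by rewrite -addSn leq_add // ltnW.
- by rewrite ltn_add2r aa.
- by rewrite ltn_add2l bb.
- by rewrite eqxx lem_add // orbT.
Qed.

Lemma wleD_eq a a' b b' :
  wle a a' -> wle b b' -> (a + b = a' + b')%MM -> a = a'.
Proof.
move=> aa bb E; have wE : (wt a + wt b = wt a' + wt b')%N by rewrite -!wtD E.
have wa := wle_wt aa; have wb := wle_wt bb.
have wEa : wt a = wt a'.
  by apply/eqP; rewrite eqn_leq wa -(leq_add2r (wt b)) wE leq_add2l.
have wEb : wt b = wt b' by apply/eqP; rewrite -(eqn_add2l (wt a)) wE wEa.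
move: aa bb; rewrite /wle wEa wEb !ltnn !eqxx /= => aa bb.
apply/eqP; case: eqVneq => // ne;
  have := ltmc_le_add (m1 := a) (m2 := b) (n1 := a') (n2 := b').
rewrite E Order.POrderTheory.ltxx => H; apply: H bb.
by rewrite Order.POrderTheory.lt_neqAle ne.
Qed.

Definition leading f m :=
  fcoef m f != 0 /\ forall k, fcoef k f != 0 -> wle m k.

Lemma leading_uniq f a b : leading f a -> leading f b -> a = b.
Proof. by move=> [fa la] [fb lb]; apply: wle_anti; [apply: la | apply: lb]. Qed.

Lemma leading_exists f : f != 0 -> exists m, leading f m.
Proof.
move=> f0; pose P w := `[< exists2 m, fcoef m f != 0 & wt m = w >].
have exP : exists w, P w.
  apply: contrapT => nP; case/eqP: f0; apply: fpsP => m; apply/eqP.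
  by apply: contrapT => /negP fm; apply: nP; exists (wt m); apply/asboolP;
    exists m.
case: (ex_minnP exP) => w /asboolP[m0 fm0 wm0] minw.
(* Among the monomials of minimal weight, which may be infinitely many, well-foundedness of the
   standard order gives a smallest one. *)
have [m [fm wm] minm] : exists2 m, fcoef m f != 0 /\ wt m = w &
    forall k, fcoef k f != 0 -> wt k = w -> (m <= k)%O.
  elim/(ltmwf (n := n)): m0 fm0 wm0 => m0 IH fm0 wm0.
  have [[k [fk wk km]]|nk] := pselect (exists k, [/\ fcoef k f != 0,
    wt k = w & (k < m0)%O]).
    exact: IH km fk wk.
  exists m0 => // k fk wk; rewrite Order.TotalTheory.leNgt.
  by apply/negP => km; apply: nk; exists k.
exists m; split=> // k fk; rewrite /wle wm.
have : (w <= wt k)%N by apply: minw; apply/asboolP; exists k.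
rewrite leq_eqVlt => /orP[/eqP wk|->] //.
by rewrite wk eqxx minm ?orbT // -wk.
Qed.

(** By [wleD_eq] the sum [a + b] is reached by no other pair of monomials of [f] and [g], so its
    coefficient is the product of two nonzero leading coefficients. *)
Lemma leadingM f g a b :
  leading f a -> leading g b -> leading (f * g) (a + b)%MM.
Proof.
move=> [fa la] [gb lb]; split; last first.
  move=> m; rewrite fcoefM => /eqP fgm.
  have [[k km [fk gk]]|nk] := pselect (exists2 k : 'X_{1..n < (mdeg m).+1},
      (bmnm k <= m)%MM & fcoef k f != 0 /\ fcoef (m - k)%MM g != 0).
    by rewrite -(submK km) addmC; apply: wleD; [apply: lb | apply: la].
  case: fgm; apply: big1 => k km; apply/eqP; rewrite mulf_eq0.
  apply: contrapT => /negP; rewrite negb_or => /andP[fk gk].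
  by apply: nk; exists k.
have ad : (mdeg a < (mdeg (a + b)).+1)%N by rewrite ltnS mdegD leq_addr.
rewrite fcoefM (bigD1 (BMultinom ad)) /= ?lem_addr //.
have -> : (a + b - a = b)%MM by rewrite addmC addmK.
rewrite big1 ?addr0 ?mulf_neq0 //.
move=> k /andP[km ka]; apply/eqP; rewrite mulf_eq0; apply: contraNT ka.
rewrite negb_or => /andP[/la ak /lb bk]; apply/eqP/val_inj => /=; symmetry.
by apply: (wleD_eq ak bk); rewrite [RHS]addmC submK // addmC.
Qed.

End LeadingMonomial.

(** * Power series over an integral domain form an integral domain *)

Section FpsIntegralDomain.
Variables (A : idomainType) (n : nat).
Implicit Types f g : fps A n.

(** Units are the invertible elements and inverses are picked by choice; this is only the way to the
    integral domain structure on which determinant arguments rely. *)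
Let funit : {pred fps A n} := fun f => `[< exists g, g * f = 1 >].
Let finv f : fps A n :=
  if pselect (exists g, g * f = 1) is left fu then projT1 (cid fu) else f.

Fact fmulVx : {in funit, left_inverse 1 finv *%R}.
Proof.
by move=> f /asboolP fu; rewrite /finv; case: pselect => // ?; case: cid.
Qed.

Fact funitPl f g : g * f = 1 -> funit f.
Proof. by move=> gf; apply/asboolP; exists g. Qed.

Fact finv_out : {in [predC funit], finv =1 id}.
Proof. by move=> f /asboolP nu; rewrite /finv; case: pselect. Qed.

HB.instance Definition _ :=
  GRing.ComNzRing_hasMulInverse.Build (fps A n) fmulVx funitPl finv_out.

Fact fmul_eq0 f g : f * g = 0 -> (f == 0) || (g == 0).
Proof.
move=> fg; apply: contrapT => /negP/norP[].
move=> /(leading_exists (fun=> 0%N))[a fa] /(leading_exists (fun=> 0%N))[b gb].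
by have [] := leadingM _ fa gb; rewrite // fg raddf0 eqxx.
Qed.

HB.instance Definition _ :=
  GRing.ComUnitRing_isIntegral.Build (fps A n) fmul_eq0.

End FpsIntegralDomain.

(** * Partial derivatives when the variables are split into two blocks *)

Section BlockVariables.
Variable A : comNzRingType.

Lemma fderiv_lsub p q i k : fderiv i (lsubmx (fid A (p + q)) 0 k) =
  (i == lshift q k)%:R.
Proof. by rewrite !mxE fderiv_var. Qed.

Lemma fderiv_rsub p q i k : fderiv i (rsubmx (fid A (p + q)) 0 k) =
  (i == rshift p k)%:R.
Proof. by rewrite !mxE fderiv_var. Qed.

Lemma fderiv_fsubst_row_mx n p q j (f : fps A (p + q)) (F : 'rV[fps A n]_p)
    (G : 'rV[fps A n]_q) : fzero_const F -> fzero_const G ->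
  fderiv j (fsubst f (row_mx F G)) =
    \sum_i fsubst (fderiv (lshift q i) f) (row_mx F G) * fderiv j (F 0 i) +
    \sum_i fsubst (fderiv (rshift p i) f) (row_mx F G) * fderiv j (G 0 i).
Proof.
move=> F0 G0; rewrite fderiv_fsubst; last exact: fzero_const_row_mx.
rewrite big_split_ord /=.
by congr (_ + _); apply: eq_bigr => i _; rewrite ?row_mxEl ?row_mxEr.
Qed.

Lemma sum_mul_delta (I : finType) (B : pzRingType) (F : I -> B) i :
  \sum_j F j * (i == j)%:R = F i.
Proof.
rewrite (bigD1 i) //= eqxx mulr1 big1 ?addr0 // => j ji.
by rewrite eq_sym (negbTE ji) mulr0.
Qed.

Lemma fderiv_lsubst p q (f : fps A p) i :
  fderiv (lshift q i) (fsubst f (lsubmx (fid A (p + q)))) =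
  fsubst (fderiv i f) (lsubmx (fid A (p + q))).
Proof.
rewrite fderiv_fsubst; last fzero.
under eq_bigr => k _ do rewrite fderiv_lsub (inj_eq (@lshift_inj _ _)).
by rewrite sum_mul_delta.
Qed.

Lemma fderiv_rsubst p q (f : fps A q) i :
  fderiv (rshift p i) (fsubst f (rsubmx (fid A (p + q)))) =
  fsubst (fderiv i f) (rsubmx (fid A (p + q))).
Proof.
rewrite fderiv_fsubst; last fzero.
under eq_bigr => k _ do rewrite fderiv_rsub (inj_eq (@rshift_inj _ _)).
by rewrite sum_mul_delta.
Qed.

Lemma fderiv_lr p q (f : fps A q) i :
  fderiv (lshift q i) (fsubst f (rsubmx (fid A (p + q)))) = 0.
Proof.
rewrite fderiv_fsubst; last fzero.
by rewrite big1 // => k _; rewrite fderiv_rsub eq_lrshift mulr0.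
Qed.

Lemma fderiv_rl p q (f : fps A p) i :
  fderiv (rshift p i) (fsubst f (lsubmx (fid A (p + q)))) = 0.
Proof.
rewrite fderiv_fsubst; last fzero.
by rewrite big1 // => k _; rewrite fderiv_lsub eq_rlshift mulr0.
Qed.

End BlockVariables.

(** * Vanishing derivatives and divisibility in characteristic zero *)

Section CharacteristicZero.
Variable A : numDomainType.

(** Each coefficient is, up to a nonzero integer factor, the constant term of an iterated
    derivative, and [P] is inherited by all of these. *)
Lemma fderiv_stable_eq0 n (P : fps A n -> Prop) :
  (forall f, P f -> fcoef 0%MM f = 0) ->
  (forall i f, P f -> P (fderiv i f)) -> forall f, P f -> f = 0.
Proof.
move=> P0 PD f Pf; apply: fpsP => m; rewrite raddf0.
move: {2}(mdeg m) (erefl (mdeg m)) => d; elim: d m f Pf => [|d IH] m f Pf md.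
  by move/eqP: md; rewrite mdeg_eq0 => /eqP ->; apply: P0.
have [i mi] : exists i, m i != 0%N.
  apply: contrapT => nm; suff m0 : m = 0%MM by rewrite m0 mdeg0 in md.
  by apply/mnmP => i; rewrite mnm0E; apply/eqP; apply: contraT => mi;
    case: nm; exists i.
have im : (U_(i) <= m)%MM by apply/mnm_lepP => j; rewrite mnm1E;
  case: eqP => // <-; rewrite lt0n.
have := IH (m - U_(i))%MM _ (PD i f Pf).
rewrite fcoef_fderiv submK // => H.
have /eqP : fcoef m f *+ ((m - U_(i))%MM i).+1 = 0.
  apply: H; apply/eqP; rewrite -(eqn_add2r (mdeg U_(i)%MM)) -mdegD submK //.
  by rewrite md mdeg1 addn1.
by rewrite mulrn_eq0 => /eqP.
Qed.

Lemma fcoef_fderiv0 n i (f : fps A n) (m : 'X_{1..n}) :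
  fderiv i f = 0 -> fcoef m f != 0 -> m i = 0%N.
Proof.
move=> fi fm; apply/eqP; apply: contraNT fm => mi.
have im : (U_(i) <= m)%MM by apply/mnm_lepP => j; rewrite mnm1E;
  case: eqP => // <-; rewrite lt0n.
have := congr1 (fcoef (m - U_(i))%MM) fi; rewrite raddf0 fcoef_fderiv submK //.
by move/eqP; rewrite mulrn_eq0.
Qed.

Lemma fsubst_row_mx0_support p q (f : fps A (p + q)) :
  fsubst f (row_mx (fid A p) 0) != 0 ->
  exists2 m, fcoef m f != 0 & forall j, m (rshift p j) = 0%N.
Proof.
move=> f0; apply: contrapT => nm; case/eqP: f0; apply: fpsP => m.
rewrite raddf0 /fcoef /= big1 // => k _.
have [[j kj]|nk] := pselect (exists j, bmnm k (rshift p j) != 0%N).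
  rewrite -/(fcoef m _) (bigD1 (rshift p j)) //= row_mxEr mxE.
  by rewrite expr0n (negbTE kj) mul0r raddf0 mulr0.
suff -> : fcoef k f = 0 by rewrite mul0r.
apply/eqP; apply: contraT => fk; case: nm; exists (bmnm k) => // j.
by apply/eqP; apply: contraT => kj; case: nk; exists j.
Qed.

(* Compare leading monomials for an order in which the degree in the last
   variables dominates. *)
Lemma fcoef0_factor_neq0 p q (f g u : fps A (p + q)) (h : fps A q) :
  f * g = u * fsubst h (rsubmx (fid A (p + q))) ->
  fsubst f (row_mx (fid A p) 0) != 0 ->
  fcoef 0%MM u != 0 -> h != 0 -> fcoef 0%MM f != 0.
Proof.
move=> fgE f1 u0 h0; set D := fsubst h _ in fgE.
pose wt (m : 'X_{1..p + q}) := (\sum_(j < q) m (rshift p j))%N.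
have wtD a b : wt (a + b)%MM = (wt a + wt b)%N.
  by rewrite /wt -big_split /=; apply: eq_bigr => j _; rewrite mnmDE.
have D0 : D != 0.
  apply: contraNneq h0 => D0.
  have r0 : fzero_const (row_mx 0 (fid A q) : 'rV[fps A q]_(p + q)) by fzero.
  by rewrite -(@fsubst_rfidK _ p q h) -/D D0 fsubst0.
have f0 : f != 0.
  apply: contraNneq f1 => ->; apply/eqP/fpsP => m.
  by rewrite /fcoef /= big1 // => k _; rewrite mul0r.
have uN0 : u != 0 by apply: contraNneq u0 => ->; rewrite raddf0.
have g0 : g != 0.
  apply: contraNneq (mulf_neq0 uN0 D0) => gE.
  by rewrite -fgE gE mulr0.
have [a fa] := leading_exists wt f0; have [b gb] := leading_exists wt g0.
have [c Dc] := leading_exists wt D0.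
(* The exponent 0 is the least monomial, so a nonzero constant term always leads. *)
have u1 : leading wt u 0%MM.
  split=> // k _; rewrite /wle.
  have -> : wt 0%MM = 0%N by rewrite /wt big1 // => j _; rewrite mnm0E.
  by case: (wt k) => //=; rewrite -[k in (_ <= k)%O]add0m lemc_addr.
have abc : (a + b = c)%MM.
  rewrite -[c]add0m; apply: (leading_uniq (leadingM wtD fa gb)).
  by rewrite fgE; apply: leadingM.
suff a0 : a = 0%MM by case: fa; rewrite a0.
(* In the first block the exponents of [a] vanish because [a + b = c] and [D] is free of these
   variables. In the second they vanish because [f] has a monomial of weight 0, so its leading
   monomial has weight 0 too. *)
apply/mnmP => i; rewrite mnm0E; case: (split_ordP i) => j ->.
  have /(congr1 (fun m : 'X_{1..p + q} => m (lshift q j))) := abc.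
  case: Dc => /(fcoef_fderiv0 (fderiv_lr _ j)) -> _.
  by rewrite mnmDE => /eqP; rewrite addn_eq0 => /andP[/eqP].
have [k fk kr] := fsubst_row_mx0_support f1.
case: fa => _ /(_ k fk); rewrite /wle.
have -> : wt k = 0%N by rewrite /wt big1.
case: (wt a =P 0%N) => [wa _|_]; last by rewrite ltn0.
by move/eqP: wa; rewrite /wt sum_nat_eq0 => /forallP/(_ j)/eqP.
Qed.

End CharacteristicZero.

(** * Complex conjugation *)

Section Conjugation.
Variable R : realType.
Local Notation C := R[i].

Lemma fcoef_fconj n (f : fps C n) (m : 'X_{1..n}) :
  fcoef m (fconj f) = (fcoef m f)^*.
Proof. by []. Qed.

Lemma fconj_is_zmod_morphism n : zmod_morphism (@fconj R n).
Proof. by move=> f g; apply: fpsP => m;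
  rewrite raddfB !fcoef_fconj !raddfB. Qed.

HB.instance Definition _ n :=
  GRing.isZmodMorphism.Build (fps C n) (fps C n) (@fconj R n)
    (@fconj_is_zmod_morphism n).

Lemma fconj_is_monoid_morphism n : monoid_morphism (@fconj R n).
Proof.
split=> [|f g]; apply: fpsP => m; rewrite fcoef_fconj.
  by rewrite fcoef1 rmorph_nat.
by rewrite !fcoefM rmorph_sum; apply: eq_bigr => k _; rewrite rmorphM.
Qed.

HB.instance Definition _ n :=
  GRing.isMonoidMorphism.Build (fps C n) (fps C n) (@fconj R n)
    (@fconj_is_monoid_morphism n).

Lemma fconjK n : involutive (@fconj R n).
Proof. by move=> f; apply: fpsP => m; rewrite !fcoef_fconj conjCK. Qed.

Lemma fconj_var n (i : 'I_n) : fconj (fvar i) = fvar i :> fps C n.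
Proof. by apply: fpsP => m; rewrite fcoef_fconj /fcoef /= rmorph_nat. Qed.

Lemma fderiv_fconj n i (f : fps C n) : fderiv i (fconj f) = fconj (fderiv i f).
Proof.
by apply: fpsP => m; rewrite fcoef_fconj !fcoef_fderiv fcoef_fconj rmorphMn.
Qed.

Lemma fconj_fsubst n p (f : fps C p) (G : 'rV[fps C n]_p) :
  fconj (fsubst f G) = fsubst (fconj f) (fmap_conj G).
Proof.
apply: fpsP => m; rewrite fcoef_fconj /fcoef /= rmorph_sum.
apply: eq_bigr => k _; rewrite rmorphM /=; congr (_ * _).
rewrite -[RHS]/(fcoef m _) -[LHS]/((fcoef m _)^*) -fcoef_fconj rmorph_prod.
by congr (fcoef m _); apply: eq_bigr => i _; rewrite rmorphXn mxE.
Qed.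

Lemma fmap_conj_comp n p q (F : 'rV[fps C p]_q) (G : 'rV[fps C n]_p) :
  fmap_conj (fcomp F G) = fcomp (fmap_conj F) (fmap_conj G).
Proof. by apply/rowP => i; rewrite !mxE fconj_fsubst. Qed.

Lemma fmap_conjK n p (F : 'rV[fps C n]_p) : fmap_conj (fmap_conj F) = F.
Proof. by apply/rowP => i; rewrite !mxE fconjK. Qed.

Lemma fmap_conj_fid n : fmap_conj (fid C n) = fid C n.
Proof. by apply/rowP => i; rewrite !mxE fconj_var. Qed.

Lemma fmap_conj0 n p : fmap_conj (0 : 'rV[fps C n]_p) = 0.
Proof. by apply/rowP => i; rewrite !mxE rmorph0. Qed.

Lemma fmap_conj_row_mx n p q (F : 'rV[fps C n]_p) (G : 'rV[fps C n]_q) :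
  fmap_conj (row_mx F G) = row_mx (fmap_conj F) (fmap_conj G).
Proof. exact: map_row_mx. Qed.

Lemma fmap_conj_lsubmx n p q (F : 'rV[fps C n]_(p + q)) :
  fmap_conj (lsubmx F) = lsubmx (fmap_conj F).
Proof. exact: map_lsubmx. Qed.

Lemma fmap_conj_rsubmx n p q (F : 'rV[fps C n]_(p + q)) :
  fmap_conj (rsubmx F) = rsubmx (fmap_conj F).
Proof. exact: map_rsubmx. Qed.

End Conjugation.

(** * Complexified maps and the reality condition *)

Section Polarization.
Variable R : realType.
Local Notation C := R[i].

Lemma fzero_const_polar n p (F : 'rV[fps C n]_p) :
  fzero_const F -> fzero_const (fpolar F).
Proof. by move=> F0; rewrite /fpolar; fzero. Qed.

Lemma fpolar_comp n p q (F : 'rV[fps C p]_q) (G : 'rV[fps C n]_p) :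
  fzero_const G -> fcomp (fpolar F) (fpolar G) = fpolar (fcomp F G).
Proof.
move=> G0; have P0 := fzero_const_polar G0.
rewrite {1}/fpolar fcomp_row_mx /fpolar fmap_conj_comp; congr row_mx.
  rewrite !fcompA; try fzero.
  by rewrite fcomp_lsubmx fid_comp; [rewrite row_mxKl | fzero].
rewrite !fcompA; try fzero.
by rewrite fcomp_rsubmx fid_comp; [rewrite row_mxKr | fzero].
Qed.

Definition fswap n : 'rV[fps C (n + n)]_(n + n) :=
  row_mx (rsubmx (fid C (n + n))) (lsubmx (fid C (n + n))).

Definition freal n (f : fps C (n + n)) := fsubst (fconj f) (fswap n) = f.

Lemma fzero_const_swap n : fzero_const (fswap n).
Proof. by rewrite /fswap; fzero. Qed.

Lemma fcomp_swap_row_mx n p (F G : 'rV[fps C p]_n) :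
  fzero_const F -> fzero_const G -> fcomp (fswap n) (row_mx F G) = row_mx G F.
Proof.
move=> F0 G0; rewrite fcomp_row_mx fcomp_lsubmx fcomp_rsubmx.
by rewrite fid_comp; [rewrite row_mxKl row_mxKr | fzero].
Qed.

(** The map [fpolar F] is unchanged when its coefficients are conjugated and the two blocks are
    exchanged both in its source and in its target. *)
Lemma freal_polar n p (f : fps C (p + p)) (F : 'rV[fps C n]_p) :
  fzero_const F -> freal f -> freal (fsubst f (fpolar F)).
Proof.
move=> F0 fR; have P0 := fzero_const_polar F0.
have Sn0 := @fzero_const_swap n; have Sp0 := @fzero_const_swap p.
rewrite /freal -[in RHS]fR fconj_fsubst !fsubstA; try fzero.
rewrite [in RHS]/fpolar fcomp_swap_row_mx; try fzero.
rewrite /fpolar fmap_conj_row_mx fcomp_row_mx !fmap_conj_comp fmap_conjK.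
rewrite fmap_conj_lsubmx fmap_conj_rsubmx fmap_conj_fid !fcompA; try fzero.
rewrite fcomp_lsubmx fcomp_rsubmx fid_comp; last by fzero.
by rewrite row_mxKl row_mxKr.
Qed.

Lemma freal_deriv n i (f : fps C (n + n)) : freal f ->
  fderiv (lshift n i) f = fsubst (fconj (fderiv (rshift n i) f)) (fswap n).
Proof.
move=> fR; rewrite -[in LHS]fR fderiv_fsubst_row_mx; try fzero.
under eq_bigr => k _ do rewrite fderiv_rsub eq_lrshift mulr0.
rewrite big1 // add0r.
under eq_bigr => k _ do rewrite fderiv_lsub (inj_eq (@lshift_inj _ _)).
by rewrite sum_mul_delta fderiv_fconj.
Qed.

End Polarization.

(** The map [(z, chi) |-> (z, q(z, chi))] is generically submersive. Differentiating [f(z, q) = 0]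
    in [chi_j] and cancelling the derivative of [q] kills [f_w] along the map; differentiating in
    [z] then kills each [f_z]. Hence the series vanishing along the map are stable under
    derivation. *)
Lemma fsubst_graph_inj (A : numDomainType) n p (q : fps A (n + p)) j
    (f : fps A (n + 1)) :
  fcoef 0%MM q = 0 -> fderiv (rshift n j) q != 0 ->
  fsubst f (row_mx (lsubmx (fid A (n + p))) (const_mx q)) = 0 -> f = 0.
Proof.
move=> q0 qj; set z := lsubmx _; set F := row_mx _ _.
have z0 : fzero_const z by rewrite /z; fzero.
have c0 : fzero_const (const_mx q : 'rV_1) by move=> i; rewrite mxE.
have F0 : fzero_const F by apply: fzero_const_row_mx.
move: f; apply: fderiv_stable_eq0 => [f fF|i f fF].
  by rewrite -(fcoef0_fsubst F0) fF raddf0.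
have fw : fsubst (fderiv (rshift n ord0) f) F = 0.
  have := congr1 (fderiv (rshift n j)) fF.
  rewrite raddf0 fderiv_fsubst_row_mx // big1 ?add0r.
    rewrite big_ord1 mxE => /eqP; rewrite mulf_eq0 (negbTE qj) orbF => /eqP.
    by [].
  by move=> k _; rewrite /z fderiv_lsub eq_rlshift mulr0.
case: (split_ordP i) => k ->; last by rewrite ord1.
have := congr1 (fderiv (lshift p k)) fF.
rewrite raddf0 fderiv_fsubst_row_mx // big_ord1 fw mul0r addr0.
under eq_bigr => l _ do rewrite /z fderiv_lsub (inj_eq (@lshift_inj _ _)).
by rewrite sum_mul_delta.
Qed.

(** * Iterated derivatives in the first block, and matrices of full generic rank *)

Section IteratedDerivative.
Variables (A : comNzRingType) (n : nat) (alpha : 'X_{1..n}).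

(* [zderiv], with an arbitrary block of further variables. *)
Definition block_deriv p (f : fps A (n + p)) : fps A (n + p) :=
  foldr (fun i f => iter (alpha i) (fderiv (lshift p i)) f) f (enum 'I_n).

Lemma block_deriv_morph p q (phi : fps A (n + p) -> fps A (n + q)) :
  (forall i f, phi (fderiv (lshift p i) f) = fderiv (lshift q i) (phi f)) ->
  forall f, phi (block_deriv f) = block_deriv (phi f).
Proof.
move=> phiD f; rewrite /block_deriv; elim: (enum _) => //= i s <-.
by elim: (alpha i) => //= k IH; rewrite phiD IH.
Qed.

Lemma fderiv_block_deriv p j (f : fps A (n + p)) :
  fderiv j (block_deriv f) = block_deriv (fderiv j f).
Proof. by apply: block_deriv_morph => i g; apply: fderivC. Qed.

(** Series in the second block are constants for the derivations of the first. *)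
Lemma block_deriv_mulr p (f : fps A (n + p)) (g : fps A p) :
  block_deriv (f * fsubst g (rsubmx (fid A (n + p)))) =
  block_deriv f * fsubst g (rsubmx (fid A (n + p))).
Proof.
symmetry; apply: (block_deriv_morph (phi := fun f => f * fsubst g _)) => i h.
by rewrite fderivM fderiv_lr mulr0 addr0.
Qed.

Lemma block_deriv_sum p (I : Type) (r : seq I) (F : I -> fps A (n + p)) :
  block_deriv (\sum_(i <- r) F i) = \sum_(i <- r) block_deriv (F i).
Proof.
rewrite /block_deriv; elim: (enum _) => //= i s ->.
by elim: (alpha i) => //= k ->; rewrite raddf_sum.
Qed.

Lemma block_deriv0 p : block_deriv (0 : fps A (n + p)) = 0.
Proof.
rewrite /block_deriv; elim: (enum _) => //= i s ->.
by elim: (alpha i) => //= k ->; rewrite raddf0.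
Qed.

End IteratedDerivative.

Lemma mulmx_col_eq0 (A : idomainType) n (M : 'M[A]_n) (v : 'cV[A]_n) :
  \det M != 0 -> M *m v = 0 -> v = 0.
Proof.
move=> dM Mv; have := congr1 (mulmx (\adj M)) Mv.
rewrite mulmxA mul_adj_mx mulmx0 mul_scalar_mx => dv.
apply/colP => i; have := congr1 (fun w : 'cV_n => w i 0) dv.
by rewrite !mxE => /eqP; rewrite mulf_eq0 (negbTE dM) => /eqP.
Qed.

(** A nonzero minor of size [n] selects rows on which the Jacobian matrix is square with nonzero
    determinant, hence injective. *)
Lemma generic_rank_full_kernel (A : idomainType) n p (F : 'rV[fps A n]_p)
    (v : 'cV[fps A n]_n) :
  generic_rank F = n -> jacobian_mx F *m v = 0 -> v = 0.
Proof.
case: n F v => [|n] F v; first by move=> _ _; apply/colP => -[].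
move=> rF Jv; pose P (r : 'I_(minn p n.+1).+1) :=
  [exists f : {ffun 'I_r -> 'I_p}, exists g : {ffun 'I_r -> 'I_n.+1},
     \det (mxsub f g (jacobian_mx F)) != 0].
have [r Pr rn] : exists2 r, P r & r = n.+1 :> nat.
  apply: contrapT => nr; have : (generic_rank F <= n)%N.
    apply/bigmax_leqP => r Pr; rewrite -ltnS ltn_neqAle -ltnS.
    have -> : (r < n.+2)%N by apply: leq_trans (ltn_ord r) _;
      rewrite ltnS geq_minr.
    by rewrite andbT; apply/eqP => rn; apply: nr; exists r.
  by rewrite rF ltnn.
case: r rn Pr => r rlt /= rn; subst r.
move=> /existsP[f /existsP[g dfg]].
apply: (@mulmx_col_eq0 _ _ (rowsub f (jacobian_mx F))); last first.
  by rewrite mul_rowsub_mx Jv; apply/matrixP => i j; rewrite !mxE.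
apply: contraNneq dfg => d0.
(* The column selection [g] is an arbitrary function; writing it as a right factor shows that the
   minor vanishes with the determinant of the selected rows. *)
rewrite (_ : mxsub f g _ = rowsub f (jacobian_mx F) *m colsub g 1%:M).
  by rewrite det_mulmx d0 mul0r.
by rewrite mulmx_colsub mulmx1; apply/matrixP => i j; rewrite !mxE.
Qed.

(** * Slices *)

Section Slices.
Variables (A : comNzRingType) (n : nat).

(* (z, chi) |-> (z, chi, 0) *)
Definition slice_map : 'rV[fps A (n + n)]_(n + (n + 1)) :=
  row_mx (lsubmx (fid A (n + n))) (row_mx (rsubmx (fid A (n + n))) 0).

Lemma fzero_const_slice : fzero_const slice_map.
Proof. by rewrite /slice_map; fzero. Qed.

Lemma fderiv_lslice i f : fderiv (lshift n i) (fsubst f slice_map) =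
  fsubst (fderiv (lshift (n + 1) i) f) slice_map.
Proof.
rewrite fderiv_fsubst_row_mx; try fzero.
rewrite [X in _ + X]big1 ?addr0.
  under eq_bigr => k _ do rewrite fderiv_lsub (inj_eq (@lshift_inj _ _)).
  by rewrite sum_mul_delta.
move=> k _; case: (split_ordP k) => l ->; last first.
  by rewrite row_mxEr mxE raddf0 mulr0.
by rewrite row_mxEl fderiv_rsub eq_lrshift mulr0.
Qed.

Lemma fderiv_rslice i f : fderiv (rshift n i) (fsubst f slice_map) =
  fsubst (fderiv (rshift n (lshift 1 i)) f) slice_map.
Proof.
rewrite fderiv_fsubst_row_mx; try fzero.
rewrite big1 ?add0r => [|k _]; last by rewrite fderiv_lsub eq_rlshift mulr0.
rewrite big_split_ord /= [X in _ + X]big1 ?addr0; last first.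
  by move=> k _; rewrite row_mxEr mxE raddf0 mulr0.
under eq_bigr => k _ do
  rewrite row_mxEl fderiv_rsub (inj_eq (@rshift_inj _ _)).
by rewrite sum_mul_delta.
Qed.

Lemma fderiv_right_slice p q j (f : fps A (p + q)) :
  fderiv j (fsubst f (row_mx 0 (fid A q))) =
  fsubst (fderiv (rshift p j) f) (row_mx 0 (fid A q)).
Proof.
rewrite fderiv_fsubst_row_mx; try fzero.
rewrite big1 ?add0r => [|k _]; last by rewrite mxE raddf0 mulr0.
under eq_bigr => k _ do rewrite mxE fderiv_var.
by rewrite sum_mul_delta.
Qed.

End Slices.

(** Since [v] depends on [chi] only, applying all derivatives in [z] to the relation and setting
    [z = 0] says that the Jacobian matrix of [zderiv_map Q k] annihilates [v]; full generic rank
    then forces [v = 0]. *)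
Lemma class_C_kernel (R : realType) N (Q : fps R[i] (N.-1 + (N.-1 + 1))) k
    (v : 'cV[fps R[i] N.-1]_N.-1) :
  generic_rank (zderiv_map Q k) = N.-1 ->
  \sum_j fderiv (rshift N.-1 j) (fsubst Q (slice_map R[i] N.-1)) *
     fsubst (v j 0) (rsubmx (fid R[i] (N.-1 + N.-1))) = 0 -> v = 0.
Proof.
set n := N.-1 in Q v *; set q := fsubst Q _; set c := rsubmx _ => rk qv.
apply: (generic_rank_full_kernel rk); apply/colP => a.
set e := row_mx (0 : 'rV_n) (fid R[i] n).
have e0 : fzero_const e by rewrite /e; fzero.
have c0 : fzero_const c by rewrite /c; fzero.
have s0 := @fzero_const_slice R[i] n.
pose al : 'X_{1..n} := bmnm (enum_val a).
(* Derivatives in [z] commute with setting [tau = 0], so [Q_{z^al}(0, chi, 0)] can be computed from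
   the slice. *)
have ze : fsubst (zderiv al Q) (row_mx 0 (row_mx (fid R[i] n) 0)) =
    fsubst (block_deriv al q) e.
  rewrite /q -(@block_deriv_morph _ n al _ _
    (fun f => fsubst f (slice_map R[i] n))).
    rewrite fsubstA; try fzero; congr fsubst.
    rewrite !fcomp_row_mx fcomp_lsubmx fcomp_rsubmx fcomp0; last fzero.
    by rewrite fid_comp; [rewrite row_mxKl row_mxKr | fzero].
  by move=> i f; rewrite fderiv_lslice.
transitivity (fsubst (block_deriv al (\sum_j
    fderiv (rshift n j) q * fsubst (v j 0) c)) e); last first.
  by rewrite qv block_deriv0 mxE fsubst0.
rewrite block_deriv_sum (fsubst_sum e0) mxE.
apply: eq_bigr => j _; rewrite block_deriv_mulr (fsubstM e0) !mxE.
by rewrite fsubst_rfidK ze fderiv_right_slice fderiv_block_deriv.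
Qed.

(** * Chain rule for a complexified map, one block at a time *)

Section PolarDerivatives.
Variables (R : realType) (n p m : nat).
Local Notation C := R[i].
Variables (f : fps C (p + p)) (F : 'rV[fps C n]_p) (G G' : 'rV[fps C m]_n).
Hypotheses (F0 : fzero_const F) (G0 : fzero_const G) (G'0 : fzero_const G').

(** In [f(F(x), \bar F(y))] only the first argument depends on [x], so the row gradient factors
    through the Jacobian matrix of [F] alone; [rgrad_polar] is the counterpart in [y]. *)
Lemma lgrad_polar :
  (\row_k fsubst (fsubst (fderiv (lshift p k) f) (fpolar F)) (row_mx G G')) *m
    map_mx (fsubst_at G0) (jacobian_mx F) =
  \row_i fsubst (fderiv (lshift n i) (fsubst f (fpolar F))) (row_mx G G').
Proof.
have GG0 : fzero_const (row_mx G G') by fzero.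
apply/rowP => i; rewrite !mxE fderiv_fsubst_row_mx; try fzero.
rewrite [X in _ = fsubst (_ + X) _]big1 ?addr0; last first.
  by move=> k _; rewrite [fcomp _ _ _ _]mxE fderiv_lr mulr0.
rewrite (fsubst_sum GG0); apply: eq_bigr => k _;
  rewrite (fsubstM GG0) !mxE fderiv_lsubst.
congr (_ * _); rewrite /= /fsubst_at fsubstA; try fzero.
by rewrite fcomp_lsubmx fid_comp; [rewrite row_mxKl | fzero].
Qed.

Lemma rgrad_polar :
  (\row_k fsubst (fsubst (fderiv (rshift p k) f) (fpolar F)) (row_mx G G')) *m
    map_mx (fsubst_at G'0) (jacobian_mx (fmap_conj F)) =
  \row_i fsubst (fderiv (rshift n i) (fsubst f (fpolar F))) (row_mx G G').
Proof.
have GG0 : fzero_const (row_mx G G') by fzero.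
apply/rowP => i; rewrite !mxE fderiv_fsubst_row_mx; try fzero.
rewrite [X in _ = fsubst (X + _) _]big1 ?add0r; last first.
  by move=> k _; rewrite [fcomp _ _ _ _]mxE fderiv_rl mulr0.
rewrite (fsubst_sum GG0); apply: eq_bigr => k _;
  rewrite (fsubstM GG0) !mxE fderiv_rsubst.
congr (_ * _); rewrite /= /fsubst_at fsubstA; try fzero.
by rewrite fcomp_rsubmx fid_comp; [rewrite row_mxKr | fzero].
Qed.

End PolarDerivatives.

(** * The normal equation and its derivatives along the first Segre set *)

Section NormalEquation.
Variables (R : realType) (N : nat).
Local Notation n := N.-1.
Local Notation C := R[i].
Variable Q : fps C (n + (n + 1)).
Hypothesis normQ : normalized Q.

Definition slice : fps C (n + n) := fsubst Q (slice_map C n).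

(* (z, chi) |-> (z, Q(z, chi, 0), chi, 0) *)
Definition segre_left : 'rV[fps C (n + n)]_(n + 1) :=
  row_mx (lsubmx (fid C (n + n))) (const_mx slice).
Definition segre_right : 'rV[fps C (n + n)]_(n + 1) :=
  row_mx (rsubmx (fid C (n + n))) 0.
Definition segre := row_mx segre_left segre_right.

Lemma fcoef0_slice : fcoef 0%MM slice = 0.
Proof.
rewrite /slice fcoef0_fsubst; last exact: fzero_const_slice.
case: normQ => /(congr1 (fcoef 0%MM)) + _.
rewrite fcoef0_fsubst; last by fzero.
by move=> ->; rewrite mxE fzero_const_fid.
Qed.

Lemma fzero_const_segre_left : fzero_const segre_left.
Proof.
apply: fzero_const_row_mx; first by fzero.
by move=> i; rewrite mxE fcoef0_slice.
Qed.

Lemma fzero_const_segre_right : fzero_const segre_right.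
Proof. by rewrite /segre_right; fzero. Qed.

Lemma fzero_const_segre : fzero_const segre.
Proof.
apply: fzero_const_row_mx; [exact: fzero_const_segre_left|].
exact: fzero_const_segre_right.
Qed.

Lemma slice_chi0 : fsubst slice (row_mx (fid C n) 0) = 0.
Proof.
have i0 : fzero_const (row_mx (fid C n) (0 : 'rV_1)) by fzero.
have s0 := @fzero_const_slice C n.
case: normQ => _ /(congr1 (fun f => fsubst f (row_mx (fid C n) 0))).
rewrite fsubstA; try fzero.
rewrite !fcomp_row_mx fcomp_lsubmx fcomp_rsubmx !fcomp0; try fzero.
rewrite fid_comp; last fzero; rewrite row_mxKl row_mxKr.
rewrite /slice fsubstA; try fzero.
rewrite !fcomp_row_mx fcomp_lsubmx fcomp_rsubmx !fcomp0; try fzero.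
rewrite fid_comp; last fzero; rewrite row_mxKl row_mxKr => ->.
rewrite fsubst_entry fcomp_rsubmx fid_comp; last fzero.
by rewrite row_mxKr mxE.
Qed.

Lemma slice_z0 : fsubst slice (row_mx 0 (fid C n)) = 0.
Proof.
have i0 : fzero_const (row_mx (fid C n) (0 : 'rV_1)) by fzero.
have s0 := @fzero_const_slice C n.
case: normQ => /(congr1 (fun f => fsubst f (row_mx (fid C n) 0))) + _.
rewrite fsubstA; try fzero.
rewrite !fcomp_row_mx fid_comp ?fcomp0; try fzero.
rewrite /slice fsubstA; try fzero.
rewrite !fcomp_row_mx fcomp_lsubmx fcomp_rsubmx !fcomp0; try fzero.
rewrite fid_comp; last fzero; rewrite row_mxKl row_mxKr => ->.
rewrite fsubst_entry fcomp_rsubmx fid_comp; last fzero.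
by rewrite row_mxKr mxE.
Qed.

End NormalEquation.

Section NormalEquationDerivatives.
Variables (R : realType) (N : nat).
Local Notation n := N.-1.
Local Notation C := R[i].
Variable Q : fps C (n + (n + 1)).
Hypothesis normQ : normalized Q.

Let zchitau : 'rV[fps C ((n + 1) + (n + 1))]_(n + (n + 1)) :=
  row_mx (lsubmx (lsubmx (fid C ((n + 1) + (n + 1)))))
    (rsubmx (fid C ((n + 1) + (n + 1)))).

Let zchitau0 : fzero_const zchitau.
Proof. by rewrite /zchitau; fzero. Qed.

Let zchitau_segre : fcomp zchitau (segre Q) = slice_map C n.
Proof.
have s0 := fzero_const_segre normQ.
rewrite fcomp_row_mx !fcomp_lsubmx fcomp_rsubmx fid_comp; last fzero.
by rewrite row_mxKr !row_mxKl.
Qed.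

Lemma normal_equation_segre : fsubst (normal_equation Q) (segre Q) = 0.
Proof.
have s0 := fzero_const_segre normQ.
rewrite /normal_equation fsubstD // fsubstN // -/zchitau fsubstA; try fzero.
rewrite zchitau_segre fsubst_entry fcomp_rsubmx fcomp_lsubmx fid_comp;
  last fzero.
by rewrite row_mxKl row_mxKr mxE subrr.
Qed.

Lemma normal_equation_dw :
  fderiv (lshift (n + 1) (rshift n ord0)) (normal_equation Q) = 1.
Proof.
rewrite /normal_equation raddfB /= !mxE fderiv_var eqxx.
rewrite fderiv_fsubst_row_mx; try fzero.
rewrite big1 ?add0r => [|k _]; last first.
  by rewrite !mxE fderiv_var (inj_eq (@lshift_inj _ _)) eq_rlshift mulr0.
by rewrite big1 ?subr0 // => k _; rewrite fderiv_rsub eq_lrshift mulr0.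
Qed.

Lemma normal_equation_dzeta i :
  fsubst (fderiv (rshift (n + 1) i) (normal_equation Q)) (segre Q) =
  - fsubst (fderiv (rshift n i) Q) (slice_map C n).
Proof.
have s0 := fzero_const_segre normQ.
rewrite /normal_equation raddfB /= !mxE fderiv_var eq_rlshift sub0r.
rewrite fderiv_fsubst_row_mx; try fzero.
rewrite big1 ?add0r => [|k _]; last first.
  by rewrite !mxE fderiv_var eq_rlshift mulr0.
under eq_bigr => k _ do rewrite fderiv_rsub (inj_eq (@rshift_inj _ _)).
rewrite sum_mul_delta (fsubstN s0); congr (- _).
by rewrite -/zchitau fsubstA; [rewrite zchitau_segre | fzero | fzero].
Qed.

(** Differentiating [Q(0, chi, tau) = tau] shows that [(Q_chi, Q_tau)] is [(0, 1)] at [z = 0]. *)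
Lemma slice_deriv_z0 i :
  fsubst (fsubst (fderiv (rshift n i) Q) (slice_map C n))
    (row_mx 0 (fid C n)) = (i == rshift n ord0)%:R.
Proof.
have e0 : fzero_const (row_mx (0 : 'rV[fps C n]_n) (fid C n)) by fzero.
have i0 : fzero_const (row_mx (fid C n) (0 : 'rV_1)) by fzero.
have s0 := @fzero_const_slice C n.
case: normQ => /(congr1 (fderiv i)) + _;
  rewrite fderiv_right_slice 2!mxE fderiv_var.
move=> /(congr1 (fun f => fsubst f (row_mx (fid C n) 0))) E.
rewrite fsubstA in E; try fzero.
rewrite !fcomp_row_mx fid_comp ?fcomp0 in E; try fzero.
rewrite fsubstA; try fzero.
rewrite !fcomp_row_mx fcomp_lsubmx fcomp_rsubmx !fcomp0; try fzero.
rewrite fid_comp; last fzero; rewrite row_mxKl row_mxKr E.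
by rewrite -[LHS]/(fsubst_at i0 _) rmorph_nat.
Qed.

End NormalEquationDerivatives.

(** * Transversality in normal coordinates, by restriction to the first Segre set *)

Section SegreTransversality.
Variables (R : realType) (N : nat).
Local Notation n := N.-1.
Local Notation C := R[i].
Local Notation K := (n + 1)%N.
Variables (Q : fps C (n + K)) (a : fps C (K + K)) (r' : fps C (K + K))
  (H : 'rV[fps C K]_K).
Hypotheses (n_gt0 : (0 < n)%N) (normQ : normalized Q) (H0 : fzero_const H)
  (r'R : freal r') (r'1 : dZ0 r' != 0).
(** The form in which the class C condition enters the argument; [class_C_kernel] provides it. *)
Hypothesis kerQ : forall v : 'cV[fps C n]_n,
  \sum_j fderiv (rshift n j) (slice Q) *
     fsubst (v j 0) (rsubmx (fid C (n + n))) = 0 -> v = 0.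
Hypothesis HJ : Jac H != 0.
Hypothesis HM : fsubst r' (fpolar H) = a * normal_equation Q.

Let rho := fsubst r' (fpolar H).
Let sigma := segre Q.
Let lam : fps C (n + n) := fsubst a sigma.
Let sigma0 : fzero_const sigma := fzero_const_segre normQ.
Let left0 := fzero_const_segre_left normQ.
Let right0 := @fzero_const_segre_right R N.
Let c : 'rV[fps C (n + n)]_n := rsubmx (fid C (n + n)).
Let c0 : fzero_const c. Proof. by rewrite /c; fzero. Qed.
Let iota : 'rV[fps C n]_K := row_mx (fid C n) 0.
Let iota0 : fzero_const iota. Proof. by rewrite /iota; fzero. Qed.
Let e1 : 'rV[fps C n]_(n + n) := row_mx (fid C n) 0.
Let e2 : 'rV[fps C n]_(n + n) := row_mx 0 (fid C n).
Let e10 : fzero_const e1. Proof. by rewrite /e1; fzero. Qed.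
Let e20 : fzero_const e2. Proof. by rewrite /e2; fzero. Qed.

(** The term containing the derivative of [a] drops out because the normal equation vanishes on the
    Segre set. *)
Let rho_deriv j :
  fsubst (fderiv j rho) sigma = lam * fsubst (fderiv j (normal_equation Q))
    sigma.
Proof.
rewrite /rho HM fderivM (fsubstD sigma0) !(fsubstM sigma0).
by rewrite normal_equation_segre // mulr0 add0r.
Qed.

Let gradl : 'rV_K := \row_k fsubst (fsubst (fderiv (lshift K k) r') (fpolar H))
  sigma.
Let gradr : 'rV_K := \row_k fsubst (fsubst (fderiv (rshift K k) r') (fpolar H))
  sigma.

Let gradlE i : (gradl *m map_mx (fsubst_at left0) (jacobian_mx H)) 0 i =
  lam * fsubst (fderiv (lshift K i) (normal_equation Q)) sigma.
Proof. by rewrite (lgrad_polar _ H0 left0 right0) mxE -rho_deriv. Qed.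

Let gradrE i : (gradr *m map_mx (fsubst_at right0) (jacobian_mx (fmap_conj H)))
  0 i =
  lam * - fsubst (fderiv (rshift n i) Q) (slice_map C n).
Proof.
by rewrite (rgrad_polar _ H0 left0 right0) mxE -normal_equation_dzeta //
  -rho_deriv.
Qed.

Let polar0 := fzero_const_polar H0.

Let fcoef0_gradl k : fcoef 0%MM (gradl 0 k) = dZ0 r' 0 k.
Proof. by rewrite !mxE !fcoef0_fsubst. Qed.

Let fcoef0_gradr k : fcoef 0%MM (gradr 0 k) = (dZ0 r' 0 k)^*.
Proof.
rewrite !mxE !fcoef0_fsubst // (freal_deriv _ r'R) fcoef0_fsubst; last first.
  exact: fzero_const_swap.
by rewrite fcoef_fconj conjCK.
Qed.

Let k_ex : exists k, dZ0 r' 0 k != 0.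
Proof. by apply/rV0Pn. Qed.

(** Otherwise the constant vector of ones, nonzero because [0 < n], would contradict [kerQ]. *)
Let slice_chi_neq0 : exists j, fderiv (rshift n j) (slice Q) != 0.
Proof.
apply: contrapT => nj; pose v : 'cV[fps C n]_n := const_mx 1.
have /(congr1 (fun v : 'cV_n => v (Ordinal n_gt0) 0)) : v = 0.
  apply: kerQ; rewrite big1 // => j _;
    suff -> : fderiv (rshift n j) (slice Q) = 0.
    by rewrite mul0r.
  by apply/eqP; apply: contraT => qj; case: nj; exists j.
by rewrite !mxE => /eqP; rewrite oner_eq0.
Qed.

(** If [lam] vanished, [gradl], which is nonzero already at the origin, would lie in the left kernel
    of the Jacobian matrix of [H] along [segre_left]. Then [Jac H] would vanish along that map,
    hence identically by [fsubst_graph_inj]. *)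
Let lam_neq0 : lam != 0.
Proof.
apply: contraNneq HJ => lam0; have [j qj] := slice_chi_neq0.
apply/eqP; apply: (fsubst_graph_inj (fcoef0_slice normQ) qj).
rewrite -[LHS]/(fsubst_at left0 _) -det_map_mx; apply/eqP/det0P.
exists gradl; last by apply/rowP => i; rewrite gradlE lam0 mul0r mxE.
have [k dk] := k_ex; apply: contraNneq dk => g0.
by rewrite -fcoef0_gradl g0 mxE raddf0.
Qed.

Let Jbar : 'M[fps C n]_K := map_mx (fsubst_at iota0) (jacobian_mx (fmap_conj
  H)).

Let map_Jbar : map_mx (fsubst_at right0) (jacobian_mx (fmap_conj H)) =
  map_mx (fsubst_at c0) Jbar.
Proof.
apply/matrixP => i j; rewrite !mxE /fsubst_at fsubstA; try fzero.
congr fsubst; rewrite fcomp_row_mx fid_comp; last fzero.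
by rewrite fcomp0.
Qed.

(** A kernel vector [v(chi)] of [Jbar] is multiplied by [gradr]; after cancelling [lam] it is
    annihilated by [(Q_chi, Q_tau)]. *)
Let det_Jbar : \det Jbar != 0.
Proof.
rewrite -det_tr; apply/det0P => -[v vn0 vJ].
have Jv : Jbar *m v^T = 0 by rewrite -[Jbar]trmxK -trmx_mul vJ trmx0.
have := congr1 (mulmx gradr \o map_mx (fsubst_at c0)) Jv.
rewrite /= map_mx0 mulmx0 map_mxM mulmxA -map_Jbar.
move=> /(congr1 (fun M : 'M_(1, 1) => M 0 0)); rewrite !mxE.
under eq_bigr => i _ do rewrite gradrE mulrN mulNr -mulrA !mxE.
rewrite sumrN => /eqP; rewrite oppr_eq0 -mulr_sumr mulf_eq0 (negbTE lam_neq0)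
  /=.
move=> /eqP Qv.
(* At [z = 0] the row [(Q_chi, Q_tau)] is [(0, 1)], which isolates the [tau] component. The
   remaining components are then handled by [kerQ]. *)
have v_tau : v 0 (rshift n ord0) = 0.
  have := congr1 (fun f => fsubst f e2) Qv;
    rewrite (fsubst_sum e20) (fsubst0 e20).
  under eq_bigr => i _ do
    rewrite (fsubstM e20) slice_deriv_z0 // fsubst_rfidK mulrC eq_sym.
  by rewrite sum_mul_delta.
case/eqP: vn0; apply/rowP => i; rewrite mxE.
case: (split_ordP i) => j ->; last by rewrite ord1.
suff /(congr1 (fun w : 'cV_n => w j 0)) : \col_j v 0 (lshift 1 j) = 0.
  by rewrite !mxE.
apply: kerQ; move: Qv; rewrite big_split_ord /= big_ord1 v_tau.
rewrite /fsubst_at (fsubst0 c0) mulr0 addr0 => Qv.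
by rewrite -[RHS]Qv; apply: eq_bigr => l _; rewrite mxE /slice fderiv_rslice.
Qed.

(** Multiplying the identity for [gradr] on the right by the adjugate of [Jbar] turns the matrix
    into its determinant and keeps the factor [lam]. *)
Let lam_dvd k : dZ0 r' 0 k != 0 ->
  exists mu, lam * mu = gradr 0 k * fsubst (\det Jbar) c.
Proof.
move=> dk; have := congr1 (mulmx gradr \o map_mx (fsubst_at c0)) (mul_mx_adj
  Jbar).
rewrite /= map_mxM mulmxA -map_Jbar map_scalar_mx mul_mx_scalar.
move=> /(congr1 (fun M : 'rV_K => M 0 k)); rewrite [in RHS]mxE => E.
eexists; rewrite [RHS]mulrC -[RHS]E mxE.
under [RHS]eq_bigr => i _ do rewrite gradrE -mulrA.
by rewrite -mulr_sumr.
Qed.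

Lemma segre_transversality : dZ0 r' *m differential0 H != 0.
Proof.
have [k dk] := k_ex; have [mu lamE] := lam_dvd dk.
have gk : fcoef 0%MM (gradr 0 k) != 0 by rewrite fcoef0_gradr conjC_eq0.
(* At [z = 0] the right side of [lamE] stays nonzero: [gradr 0 k] has a nonzero constant term and
   the determinant depends on [chi] only. *)
have lam2 : fsubst lam e2 != 0.
  have /eqP := congr1 (fun f => fsubst f e2) lamE; apply: contraTneq => lam20.
  rewrite !(fsubstM e20) lam20 mul0r eq_sym mulf_eq0 negb_or.
  rewrite fsubst_rfidK det_Jbar andbT.
  by apply: contraNneq gk => g0; rewrite -(fcoef0_fsubst e20) g0 raddf0.
pose w : 'I_K := rshift n ord0.
(* The Segre set contains the points [(z, 0, 0, 0)] and [(0, 0, chi, 0)], which the exchange of the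
   two blocks maps to each other. *)
have sigma1 : fcomp sigma e1 = row_mx iota 0.
  rewrite /sigma /segre !fcomp_row_mx fcomp_lsubmx fcomp_rsubmx fid_comp //.
  rewrite row_mxKl row_mxKr !fcomp0 // row_mx0; congr (row_mx (row_mx _ _) _).
  by apply/rowP => i; rewrite !mxE slice_chi0.
have sigma2 : fcomp sigma e2 = row_mx 0 iota.
  rewrite /sigma /segre !fcomp_row_mx fcomp_lsubmx fcomp_rsubmx fid_comp //.
  rewrite row_mxKl row_mxKr !fcomp0 // ; congr row_mx.
  rewrite -row_mx0; congr row_mx.
  by apply/rowP => i; rewrite !mxE slice_z0.
have rho_w : fsubst (fderiv (lshift K w) rho) sigma = lam.
  rewrite rho_deriv normal_equation_dw.
  by rewrite (fsubst1 sigma0) mulr1.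
(* On the Segre set [rho_w] is [lam] and [rho_tau] is [- lam * Q_tau], with [Q_tau = 1] at [z = 0].
   Reality of [rho] relates [rho_w] at [(z, 0, 0, 0)] to the conjugate of [rho_tau] at the exchanged
   point, so [lam(z, 0)] is minus the conjugate of [lam(0, chi)] with [chi] renamed to [z]. *)
have lam1 : fsubst lam e1 != 0.
  have rhoR : freal rho := freal_polar H0 r'R.
  rewrite -rho_w fsubstA // sigma1 (freal_deriv _ rhoR).
  rewrite fsubstA; [|exact: fzero_const_swap|fzero].
  rewrite fcomp_swap_row_mx; try fzero.
  have ciota : fmap_conj iota = iota.
    by rewrite /iota fmap_conj_row_mx fmap_conj0 fmap_conj_fid.
  have -> : row_mx (0 : 'rV_K) iota = fmap_conj (row_mx 0 iota).
    by rewrite fmap_conj_row_mx fmap_conj0 ciota.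
  rewrite -fconj_fsubst -sigma2 -fsubstA // rho_deriv normal_equation_dzeta //.
  rewrite (fsubstM e20) (fsubstN e20).
  rewrite slice_deriv_z0 // eqxx mulrN1.
  apply: contraNneq lam2 => /(congr1 (@fconj R n)).
  by rewrite fconjK raddf0 => /eqP; rewrite oppr_eq0.
have lam0 := fcoef0_factor_neq0 lamE lam1 gk det_Jbar.
apply: contraNneq lam0 => dH.
(* The constant term of [gradlE] in the direction [w], where the normal equation has derivative
   1. *)
have -> : fcoef 0%MM lam = (dZ0 r' *m differential0 H) 0 w.
  rewrite -[lam]mulr1 -(fsubst1 sigma0) -(normal_equation_dw Q) -gradlE.
  rewrite [X in fcoef _ X]mxE [RHS]mxE raddf_sum.
  apply: eq_bigr => l _; rewrite [LHS]fcoef0M fcoef0_gradl; congr (_ * _).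
  by rewrite !mxE fcoef0_fsubst.
by rewrite dH mxE.
Qed.

End SegreTransversality.

(** The target dimension [N'] is a variable with an equation, so that [subst] identifies it with
    [N.-1 + 1] without casts. The Jacobian condition is stated through the left kernel because the
    matrix is not yet square by its type. *)
Lemma normal_transversality (R : realType) N N' (Q : fps R[i] (N.-1 + (N.-1 +
  1)))
    (a : fps R[i] (N.-1 + 1 + (N.-1 + 1))) (r : fps R[i] (N' + N'))
    (H : 'rV[fps R[i] (N.-1 + 1)]_N') k :
  N' = (N.-1 + 1)%N -> (0 < N.-1)%N -> normalized Q -> fzero_const H ->
  freal r -> dZ0 r != 0 -> generic_rank (zderiv_map Q k) = N.-1 ->
  (forall u : 'rV[fps R[i] (N.-1 + 1)]_N', u *m jacobian_mx H = 0 -> u = 0) ->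
  fsubst r (fpolar H) = a * normal_equation Q ->
  dZ0 r *m differential0 H != 0.
Proof.
move=> E; subst N' => n_gt0 normQ H0 rR r1 rk HJ HM.
apply: (segre_transversality n_gt0 normQ H0 rR r1 _ _ HM) => [v|].
  exact: class_C_kernel rk.
by apply/det0P => -[u un0 /HJ u0]; rewrite u0 eqxx in un0.
Qed.

(** * Transport through a formal change of coordinates, and the geometric conclusion *)

Lemma differential0_comp (A : comNzRingType) n p q (F : 'rV[fps A p]_q)
    (G : 'rV[fps A n]_p) : fzero_const G ->
  differential0 (fcomp F G) = differential0 F *m differential0 G.
Proof.
move=> G0; rewrite /differential0 (jacobian_mx_comp _ G0) map_mxM;
  congr (_ *m _).
by apply/matrixP => i j; rewrite !mxE; apply: (fcoef0_fsubst G0).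
Qed.

Lemma coordinate_change_jacobian (A : idomainType) n p q (H : 'rV[fps A p]_q)
    (Z : 'rV[fps A n]_p) (Z0 : fzero_const Z) (u : 'rV[fps A n]_q) :
  formal_coordinate_change Z -> u *m jacobian_mx (fcomp H Z) = 0 ->
  u *m map_mx (fsubst_at Z0) (jacobian_mx H) = 0.
Proof.
case=> _ [G [G0 ZG GZ]]; rewrite (jacobian_mx_comp _ Z0) mulmxA => uJ.
(* Differentiating [Z(G) = id] and then substituting [Z] inverts the Jacobian matrix of [Z] on the
   right; [G(Z) = id] restores its original argument. *)
have J1 : jacobian_mx Z *m map_mx (fsubst_at Z0) (jacobian_mx G) = 1%:M.
  have := congr1 (fun F => map_mx (fsubst_at Z0) (jacobian_mx F)) ZG.
  rewrite (jacobian_mx_comp _ G0) map_mxM jacobian_mx_fid map_mx1 => <-.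
  congr (_ *m _); apply/matrixP => i j; rewrite !mxE.
  by rewrite -[LHS]fsubst_fid -GZ -(fsubstA _ G0 Z0).
by rewrite -[LHS]mulmx1 -J1 mulmxA uJ mul0mx.
Qed.

Lemma fsubst_coordinate_change_eq0 (A : comNzRingType) n p (Z : 'rV[fps A n]_p)
    (f : fps A p) :
  formal_coordinate_change Z -> fsubst f Z = 0 -> f = 0.
Proof.
case=> Z0 [G [G0 ZG GZ]] fZ.
by rewrite -(fsubst_fid f) -ZG -fsubstA // fZ fsubst0.
Qed.

(** The kernel of the row [d] has codimension at most one, and the image of the differential is not
    contained in it, so adding the image yields the whole space. *)
Lemma CR_transversal_of_neq0 (R : realType) N (H : 'rV[fps R[i] N]_N)
    (M : formal_hypersurface R N) :
  dZ0 M *m differential0 H != 0 -> CR_transversal H M.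
Proof.
rewrite /CR_transversal /T10; set d := dZ0 M; set L := differential0 H => dL.
have nsub : ~~ (L^T <= kermx d^T)%MS.
  by rewrite sub_kermx -trmx_mul -(inj_eq trmx_inj) trmxK trmx0.
apply/eqmxP; rewrite submx1 /= sub1mx /row_full eqn_leq rank_leq_col /=.
have : (kermx d^T < kermx d^T + L^T)%MS.
  rewrite /ltmx addsmxSl /=; apply: contra nsub => sub.
  exact: submx_trans (addsmxSr _ _) sub.
rewrite ltmxErank => /andP[_]; rewrite mxrank_ker ltn_subLR ?rank_leq_row //.
move=> lt; rewrite -ltnS; apply: leq_trans lt _.
exact: (leq_add (rank_leq_col d^T) (leqnn _)).
Qed.

Theorem corollary2p3 (R : realType) (N : nat) (hN : (2 <= N)%N)
    (M M' : formal_hypersurface R N) (hM : class_C M)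
    (H : 'rV[fps R[i] N]_N) (H0 : fzero_const H)
    (HM : sends_into H M M') (HJ : Jac H <> 0) :
  CR_transversal H M'.
Proof.
apply: CR_transversal_of_neq0.
have n_gt0 : (0 < N.-1)%N by rewrite -ltnS prednK // ltnW.
have NE : N = (N.-1 + 1)%N by rewrite addn1 prednK // ltnW.
case: hM => Z [Q [[cZ normQ idealQ] [k /(_ k (leqnn k)) rk]]].
have Z0 : fzero_const Z by case: cZ.
have [b Hb] := HM.
have P0 := fzero_const_polar Z0; have PH0 := fzero_const_polar H0.
(* The inclusion of ideals is pulled back by the complexified coordinates, where the ideal of [M] is
   generated by the normal equation. *)
have [a Ha] : in_ideal (normal_equation Q) (fsubst M' (fpolar (fcomp H Z))).
  apply/idealQ; exists (fsubst b (fpolar Z)).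
  by rewrite -fpolar_comp // -fsubstA // Hb fsubstM.
have HZ0 : fzero_const (fcomp H Z) by fzero.
have := normal_transversality NE n_gt0 normQ HZ0 (defining_real M')
  (defining_dZ0 M') rk _ Ha.
rewrite differential0_comp // mulmxA => dH.
(* The covector for [H] composed with [Z] is the one for [H] times the differential of [Z], so it
   suffices that the former is nonzero. *)
apply: contraTneq (dH _) => [->|u uJ]; first by rewrite mul0mx eqxx.
have uH := coordinate_change_jacobian Z0 cZ uJ.
(* A nonzero left kernel vector would make [Jac H] vanish after substituting [Z], hence identically
   since [Z] is invertible. *)
apply/eqP; apply: contraT => u0; case: HJ.
apply: (fsubst_coordinate_change_eq0 cZ).
rewrite -[LHS]/(fsubst_at Z0 _) -det_map_mx; apply/eqP/det0P.
by exists u.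
Qed.
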